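(* Let $\varphi\colon R\to A$ be a finite ring homomorphism such that $\varphi$ is a quasi-faithfully flat extension, where $R$ is a Noetherian ring. Suppose that $A$, viewed as a left $R$-module, is Gorenstein projective, and that $\operatorname{Hom}_R(A,R)$ is projective as a left $A$-module. Then for each $k>0$, the category of $k$-torsionfree left $R$-modules is extension closed if and only if the category of $k$-torsionfree left $A$-modules is extension closed.
   Context: A ring is Noetherian if it is left and right Noetherian. Modules are left modules unless stated otherwise; $R^{\mathrm{op}}$-modules are right $R$-modules. A ring homomorphism $R\to A$ is finite if $A$ is finitely generated both as a left and as a right $R$-module. A ring homomorphism $\varphi\colon R\to A$ is a quasi-faithfully flat extension if there exists an $A$-$R$-bimodule $T$ such that (1) $T$ is a finitely generated projective left $A$-module; (2) $T$ is faithfully flat as a right $R$-module; (3) $\operatorname{Hom}_A(T,A)$ is flat as a left $R$-module. For a finitely generated left $R$-module $M$ and an exact sequence $P_1\xrightarrow{f}P_0\to M\to 0$ with $P_0,P_1$ finitely generated projective, $\operatorname{Tr}_R(M)=\operatorname{coker}(\operatorname{Hom}_R(f,R))$ (a right $R$-module, independent of choices up to projective summands). For $k>0$, $M$ is $k$-torsionfree if $\operatorname{Ext}^i_{R^{\mathrm{op}}}(\operatorname{Tr}_R(M),R)=0$ for all $1\le i\le k$. The category of $k$-torsionfree left $R$-modules is the full subcategory of the category of finitely generated left $R$-modules consisting of these modules; similarly for $A$. A full subcategory $\mathcal X$ of the category of finitely generated left $R$-modules is extension closed if for each short exact sequence $0\to X\to Y\to Z\to 0$ of finitely generated left $R$-modules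 with $X,Z\in\mathcal X$, also $Y\in\mathcal X$. An $R$-module is Gorenstein projective if it is the image of a differential of an acyclic complex $\mathbf P$ of projective $R$-modules such that $\operatorname{Hom}_R(\mathbf P,Q)$ is acyclic for every projective $R$-module $Q$. $\operatorname{Hom}_R(A,R)$ denotes left $R$-linear maps, a left $A$-module via right multiplication of $A$ on the source. *)

(* Defs.v *)
From HB Require Import structures.
From mathcomp Require Import all_boot all_algebra.
From mathcomp Require Import boolp.
From mathcomp Require Import freeg.

Set Implicit Arguments.
Unset Strict Implicit.
Unset Printing Implicit Defensive.

Import GRing.Theory.
Local Open Scope ring_scope.
Local Open Scope quotient_scope.

(* Rings are unital, not necessarily commutative, possibly zero (pzRingType).
   A left R-module is an [lmodType R].  A right R-module, i.e. an R^op-module,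
   is an [lmodType R^c] over the converse ring: in R^c the product of a and b is
   [b * a], so that [a *: x] over R^c reads x a.  In particular [R^c^o] is R
   regarded as a right module over itself. *)

(* Exactness of U -f-> V -g-> W at V. *)
Definition exact_at (U : Type) (V W : zmodType) (f : U -> V) (g : V -> W) :=
  forall v : V, g v = 0 <-> exists u : U, f u = v.

Definition surjective (U V : Type) (f : U -> V) :=
  forall v : V, exists u : U, f u = v.

Section ModuleProperties.
Variable S : pzRingType.

Definition finitely_generated (M : lmodType S) :=
  exists (n : nat) (e : 'I_n -> M),
    forall x : M, exists c : 'I_n -> S, x = \sum_(i < n) c i *: e i.

Definition noetherian_module (M : lmodType S) :=
  forall I : nat -> {pred M},
    (forall n, submod_closed (I n)) ->
    (forall n, {subset I n <= I n.+1}) ->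
    exists m : nat, forall n : nat, (m <= n)%N -> I n =i I m.

Definition projective (P : lmodType S) :=
  forall (M N : lmodType S) (g : {linear M -> N}) (f : {linear P -> N}),
    surjective g -> exists h : {linear P -> M}, forall x, g (h x) = f x.

Definition fg_projective (P : lmodType S) :=
  finitely_generated P /\ projective P.

End ModuleProperties.

Definition noetherian_ring (R : pzRingType) :=
  noetherian_module R^o /\ noetherian_module R^c^o.

(* The abelian group Hom_S(M, N), under pointwise addition. *)
Definition Hom (S : pzRingType) (M N : lmodType S) : Type := {linear M -> N}.

Section HomGroup.
Variables (S : pzRingType) (M N : lmodType S).

HB.instance Definition _ := gen_eqMixin (Hom M N).
HB.instance Definition _ := gen_choiceMixin (Hom M N).

Lemma Hom_ext (f g : Hom M N) : f =1 g -> f = g.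
Proof.
move: f g => [f [[hf] [hf']]] [g [[hg] [hg']]] /= /funext fg.
case: _ / fg in hg hg' *.
by rewrite (Prop_irrelevance hf hg) (Prop_irrelevance hf' hg').
Qed.

Definition Hom_zero : Hom M N := (\0 : M -> N).
Definition Hom_opp (f : Hom M N) : Hom M N := (\- f).
Definition Hom_add (f g : Hom M N) : Hom M N := (f \+ g).

Fact Hom_addA : associative Hom_add.
Proof. by move=> f g h; apply: Hom_ext => x; rewrite /= addrA. Qed.
Fact Hom_addC : commutative Hom_add.
Proof. by move=> f g; apply: Hom_ext => x; rewrite /= addrC. Qed.
Fact Hom_add0 : left_id Hom_zero Hom_add.
Proof. by move=> f; apply: Hom_ext => x; rewrite /= add0r. Qed.
Fact Hom_addN : left_inverse Hom_zero Hom_opp Hom_add.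
Proof. by move=> f; apply: Hom_ext => x; rewrite /= addNr. Qed.

HB.instance Definition _ := GRing.isZmodule.Build (Hom M N)
  Hom_addA Hom_addC Hom_add0 Hom_addN.

End HomGroup.

(* Hom_S(f, Q) *)
Definition precomp (S : pzRingType) (M N Q : lmodType S) (f : {linear M -> N})
  (g : Hom N Q) : Hom M Q := (g \o f).

(* The right module Hom_R(M, R), with (f a)(x) = f(x) a. *)
Definition dual (R : pzRingType) (M : lmodType R) : Type := Hom M R^o.

Section DualModule.
Variables (R : pzRingType) (M : lmodType R).

HB.instance Definition _ := GRing.Zmodule.on (dual M).

Definition dual_fun (a : R) (f : dual M) (x : M) : R^o := (f : Hom M R^o) x * a.

Fact dual_linear a f : linear (dual_fun a f).
Proof.
by move=> b x y; rewrite /dual_fun linearP mulrDl /= -[b *: f x * a]mulrA.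
Qed.
HB.instance Definition _ a f :=
  GRing.isLinear.Build R M R^o *:%R (dual_fun a f) (dual_linear a f).

Definition dual_act (a : R^c) (f : dual M) : dual M :=
  (dual_fun a f : {linear M -> R^o}).

Fact dual_actA a b f : dual_act a (dual_act b f) = dual_act (a * b) f.
Proof. by apply: Hom_ext => x; exact/esym/mulrA. Qed.
Fact dual_act1 : left_id 1 dual_act.
Proof. by move=> f; apply: Hom_ext => x; exact: mulr1. Qed.
Fact dual_actDr : right_distributive dual_act +%R.
Proof. by move=> a f g; apply: Hom_ext => x; exact: mulrDl. Qed.
Fact dual_actDl f : {morph dual_act^~ f : a b / a + b}.
Proof. by move=> a b; apply: Hom_ext => x; exact: mulrDr. Qed.

HB.instance Definition _ := GRing.Zmodule_isLmodule.Build R^c (dual M)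
  dual_actA dual_act1 dual_actDr dual_actDl.

End DualModule.

Definition dual_map (R : pzRingType) (M N : lmodType R) (f : {linear M -> N}) :
  dual N -> dual M := precomp f.

(* A-R-bimodules: [ract x a] is x a for x : T and a : R. *)
Record bimodule (A R : pzRingType) := Bimodule {
  bimod_left :> lmodType A;
  ract : bimod_left -> R -> bimod_left;
  ractA : forall x a b, ract (ract x a) b = ract x (a * b);
  ract1 : forall x, ract x 1 = x;
  ractDl : forall a, {morph ract^~ a : x y / x + y};
  ractDr : forall x, {morph ract x : a b / a + b};
  ractZ : forall c a x, ract (c *: x) a = c *: ract x a
}.

(* The underlying right module of a bimodule. *)
Definition bimod_right (A R : pzRingType) (T : bimodule A R) : Type := T.

Section BimoduleRight.
Variables (A R : pzRingType) (T : bimodule A R).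

HB.instance Definition _ := GRing.Zmodule.on (bimod_right T).

Definition bimod_right_act (a : R^c) (x : bimod_right T) : bimod_right T :=
  ract x a.

Fact bimod_right_actA a b x :
  bimod_right_act a (bimod_right_act b x) = bimod_right_act (a * b) x.
Proof. exact: ractA. Qed.
Fact bimod_right_act1 : left_id 1 bimod_right_act.
Proof. exact: ract1. Qed.
Fact bimod_right_actDr : right_distributive bimod_right_act +%R.
Proof. by move=> a x y; exact: ractDl. Qed.
Fact bimod_right_actDl x : {morph bimod_right_act^~ x : a b / a + b}.
Proof. by move=> a b; exact: ractDr. Qed.

HB.instance Definition _ := GRing.Zmodule_isLmodule.Build R^c (bimod_right T)
  bimod_right_actA bimod_right_act1 bimod_right_actDr bimod_right_actDl.

End BimoduleRight.

(* For an A-R-bimodule T and a left A-module N, Hom_A(T, N) is a left R-module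
   with (a f)(x) = f(x a). *)
Definition bimod_Hom (A R : pzRingType) (T : bimodule A R) (N : lmodType A) :
  Type := Hom T N.

Section BimoduleHom.
Variables (A R : pzRingType) (T : bimodule A R) (N : lmodType A).

HB.instance Definition _ := GRing.Zmodule.on (bimod_Hom T N).

Definition bimod_Hom_fun (a : R) (f : bimod_Hom T N) (x : T) : N :=
  (f : Hom T N) (ract x a).

Fact bimod_Hom_linear a f : linear (bimod_Hom_fun a f).
Proof. by move=> b x y; rewrite /bimod_Hom_fun ractDl ractZ linearP. Qed.
HB.instance Definition _ a f := GRing.isLinear.Build A T N *:%R
  (bimod_Hom_fun a f) (bimod_Hom_linear a f).

Definition bimod_Hom_act (a : R) (f : bimod_Hom T N) : bimod_Hom T N :=
  (bimod_Hom_fun a f : {linear T -> N}).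

Fact bimod_Hom_actA a b f :
  bimod_Hom_act a (bimod_Hom_act b f) = bimod_Hom_act (a * b) f.
Proof.
by apply: Hom_ext => x; rewrite /= /bimod_Hom_fun /= /bimod_Hom_fun ractA.
Qed.
Fact bimod_Hom_act1 : left_id 1 bimod_Hom_act.
Proof. by move=> f; apply: Hom_ext => x; rewrite /= /bimod_Hom_fun ract1. Qed.
Fact bimod_Hom_actDr : right_distributive bimod_Hom_act +%R.
Proof. by move=> a f g; apply: Hom_ext => x. Qed.
Fact bimod_Hom_actDl f : {morph bimod_Hom_act^~ f : a b / a + b}.
Proof.
by move=> a b; apply: Hom_ext => x; rewrite /= /bimod_Hom_fun ractDr linearD.
Qed.

HB.instance Definition _ := GRing.Zmodule_isLmodule.Build R (bimod_Hom T N)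
  bimod_Hom_actA bimod_Hom_act1 bimod_Hom_actDr bimod_Hom_actDl.

End BimoduleHom.

(* The two bimodule structures that a ring homomorphism phi : R -> A puts on A:
   [restr_right phi] is A as an A-R-bimodule, [restr_left phi] is A as an
   R-A-bimodule. *)
Section RestrictionOfScalars.
Variables (R A : pzRingType) (phi : {rmorphism R -> A}).

Program Definition restr_right : bimodule A R :=
  @Bimodule A R A^o (fun x a => (x : A) * phi a) _ _ _ _ _.
Next Obligation. by rewrite rmorphM mulrA. Qed.
Next Obligation. by rewrite rmorph1 mulr1. Qed.
Next Obligation. by move=> x y; rewrite mulrDl. Qed.
Next Obligation. by move=> a b; rewrite rmorphD mulrDr. Qed.
Next Obligation. exact/esym/mulrA. Qed.

Definition restr : Type := A.
HB.instance Definition _ := GRing.Zmodule.on restr.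

Definition restr_act (a : R) (x : restr) : restr := phi a * x.

Fact restr_actA a b x : restr_act a (restr_act b x) = restr_act (a * b) x.
Proof. by rewrite /restr_act rmorphM mulrA. Qed.
Fact restr_act1 : left_id 1 restr_act.
Proof. by move=> x; rewrite /restr_act rmorph1 mul1r. Qed.
Fact restr_actDr : right_distributive restr_act +%R.
Proof. by move=> a x y; rewrite /restr_act mulrDr. Qed.
Fact restr_actDl x : {morph restr_act^~ x : a b / a + b}.
Proof. by move=> a b; rewrite /restr_act rmorphD mulrDl. Qed.

HB.instance Definition _ := GRing.Zmodule_isLmodule.Build R restr
  restr_actA restr_act1 restr_actDr restr_actDl.

Program Definition restr_left : bimodule R A :=
  @Bimodule R A restr (fun x a => (x : A) * a) _ _ _ _ _.
Next Obligation. by rewrite mulrA. Qed.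
Next Obligation. by rewrite mulr1. Qed.
Next Obligation. by move=> x y; exact: mulrDl. Qed.
Next Obligation. by move=> a b; exact: mulrDr. Qed.
Next Obligation. exact/esym/mulrA. Qed.

End RestrictionOfScalars.

Definition finite_rmorphism (R A : pzRingType) (phi : {rmorphism R -> A}) :=
  finitely_generated (restr_left phi) /\
  finitely_generated (bimod_right (restr_right phi)).

(* X (x)_R M for a right module X and a left module M: the free abelian group on
   X * M modulo the subgroup generated by the bilinearity relations. *)
Section Tensor.
Variables (R : pzRingType) (X : lmodType R^c) (M : lmodType R).

Definition tensor_relator (u : {freeg (X * M)%type / int}) : Prop :=
  [\/ exists x x' m, u = << (x + x', m) >> - << (x, m) >> - << (x', m) >>,
      exists x m m', u = << (x, m + m') >> - << (x, m) >> - << (x, m') >>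
    | exists (a : R) x m, u = << ((a : R^c) *: x, m) >> - << (x, a *: m) >>].

Definition tensor_relations : {pred {freeg (X * M)%type / int}} :=
  fun u => `[< forall I : {pred {freeg (X * M)%type / int}},
    zmod_closed I -> (forall v, tensor_relator v -> v \in I) -> u \in I >].

Fact tensor_relations_zmod_closed : zmod_closed tensor_relations.
Proof.
split=> [|u v /asboolP Iu /asboolP Iv]; apply/asboolP => I Iz Irel.
  by case: Iz.
by case: (Iz) => _; apply; [exact: Iu | exact: Iv].
Qed.
HB.instance Definition _ := GRing.isZmodClosed.Build _ tensor_relations
  tensor_relations_zmod_closed.

Definition tensor : zmodType := Quotient.quot tensor_relations.

Definition tens (x : X) (m : M) : tensor := \pi_tensor << (x, m) >>.

End Tensor.

Arguments tensor_relations {R} X M.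

Section TensorMap.
Variables (R : pzRingType) (X X' : lmodType R^c) (M M' : lmodType R).
Variables (f : {linear X -> X'}) (g : {linear M -> M'}).

Definition free_map (u : {freeg (X * M)%type / int}) :
    {freeg (X' * M')%type / int} :=
  fglift (fun xm => << (f xm.1, g xm.2) >>) u.

(* f (x) g *)
Definition tensor_map (t : tensor X M) : tensor X' M' :=
  \pi_(tensor X' M') (free_map (repr t)).

Lemma free_mapB : {morph free_map : u v / u - v}.
Proof. exact: lift_is_additive. Qed.

Lemma free_mapU k : free_map << k >> = << (f k.1, g k.2) >>.
Proof. by rewrite /free_map liftU scale1r. Qed.

Lemma free_map_relations u :
  u \in tensor_relations X M -> free_map u \in tensor_relations X' M'.
Proof.
move=> /asboolP/(_ (fun v => free_map v \in tensor_relations X' M')); apply.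
  split=> [|v w Iv Iw].
    by rewrite unfold_in /= -(subrr 0) free_mapB subrr rpred0.
  by rewrite unfold_in /= free_mapB rpredB.
move=> v Rv; rewrite unfold_in /=; apply/asboolP => I Iz; apply.
case: Rv => [[x [x' [m ->]]] | [x [m [m' ->]]] | [a [x [m ->]]]];
  rewrite !free_mapB !free_mapU /=.
- by constructor 1; exists (f x), (f x'), (g m); rewrite linearD.
- by constructor 2; exists (f x), (g m), (g m'); rewrite linearD.
- by constructor 3; exists a, (f x), (g m); rewrite !linearZ.
Qed.

Lemma tensor_map_pi u :
  tensor_map (\pi_(tensor X M) u) = \pi_(tensor X' M') (free_map u).
Proof.
apply/eqP; rewrite -Quotient.idealrBE -free_mapB; apply: free_map_relations.
by rewrite Quotient.idealrBE reprK.
Qed.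

Lemma tensor_map_tens x m : tensor_map (tens x m) = tens (f x) (g m).
Proof. by rewrite /tens tensor_map_pi free_mapU. Qed.

End TensorMap.

Section Flatness.
Variable R : pzRingType.

(* T (x)_R - is exact on left R-modules *)
Definition flat_right (T : lmodType R^c) :=
  forall (L M N : lmodType R) (f : {linear L -> M}) (g : {linear M -> N}),
    exact_at f g ->
    exact_at (tensor_map (idfun : {linear T -> T}) f)
             (tensor_map (idfun : {linear T -> T}) g).

Definition faithfully_flat_right (T : lmodType R^c) :=
  forall (L M N : lmodType R) (f : {linear L -> M}) (g : {linear M -> N}),
    exact_at f g <->
    exact_at (tensor_map (idfun : {linear T -> T}) f)
             (tensor_map (idfun : {linear T -> T}) g).

(* - (x)_R M is exact on right R-modules *)
Definition flat_left (M : lmodType R) :=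
  forall (X Y Z : lmodType R^c) (f : {linear X -> Y}) (g : {linear Y -> Z}),
    exact_at f g ->
    exact_at (tensor_map f (idfun : {linear M -> M}))
             (tensor_map g (idfun : {linear M -> M})).

End Flatness.

(* phi : R -> A enters only through its source and target. *)
Definition quasi_faithfully_flat_extension (R A : pzRingType)
    (phi : {rmorphism R -> A}) :=
  exists T : bimodule A R,
    [/\ fg_projective T,
        faithfully_flat_right (bimod_right T) &
        flat_left (bimod_Hom T A^o)].

(* P 0 <- P 1 <- P 2 <- ... is a projective resolution of N, augmented by eps. *)
Definition projective_resolution (S : pzRingType) (N : lmodType S)
    (P : nat -> lmodType S) (d : forall n, {linear P n.+1 -> P n})
    (eps : {linear P 0%N -> N}) :=
  [/\ forall n, projective (P n),
      surjective eps,
      exact_at (d 0%N) eps &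
      forall n, exact_at (d n.+1) (d n)].

(* Ext^i_S(N, Q) = 0: the complex Hom_S(P, Q) has no cohomology in degree i. *)
Definition Ext_vanishes (S : pzRingType) (i : nat) (N Q : lmodType S) :=
  exists (P : nat -> lmodType S) (d : forall n, {linear P n.+1 -> P n})
         (eps : {linear P 0%N -> N}),
    projective_resolution d eps /\
    match i with
    | 0%N => forall f : Hom (P 0%N) Q, precomp (d 0%N) f = 0 -> f = 0
    | j.+1 => exact_at (precomp (Q := Q) (d j)) (precomp (Q := Q) (d j.+1))
    end.

Section Torsionfree.
Variable R : pzRingType.

(* N is the right module Tr_R(M), computed from some presentation of M. *)
Definition is_transpose (M : lmodType R) (N : lmodType R^c) :=
  exists (P1 P0 : lmodType R) (f : {linear P1 -> P0}) (p : {linear P0 -> M})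
         (q : {linear dual P1 -> N}),
    [/\ fg_projective P1 /\ fg_projective P0,
        exact_at f p /\ surjective p &
        exact_at (dual_map f) q /\ surjective q].

Definition torsionfree (k : nat) (M : lmodType R) :=
  finitely_generated M /\
  exists N : lmodType R^c,
    is_transpose M N /\
    forall i : nat, (1 <= i <= k)%N -> Ext_vanishes i N R^c^o.

Definition extension_closed (C : lmodType R -> Prop) :=
  forall (X Y Z : lmodType R) (f : {linear X -> Y}) (g : {linear Y -> Z}),
    finitely_generated X -> finitely_generated Y -> finitely_generated Z ->
    injective f -> exact_at f g -> surjective g ->
    C X -> C Z -> C Y.

(* M is (isomorphic to) the image of a differential d i = j \o p. *)
Definition Gorenstein_projective (M : lmodType R) :=
  exists (P : int -> lmodType R) (d : forall i, {linear P i -> P (i + 1)}),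
    [/\ forall i, projective (P i),
        forall i, exact_at (d i) (d (i + 1)),
        forall Q : lmodType R, projective Q -> forall i,
          exact_at (precomp (Q := Q) (d (i + 1))) (precomp (Q := Q) (d i)) &
        exists (i : int) (p : {linear P i -> M}) (j : {linear M -> P (i + 1)}),
          [/\ surjective p, injective j & forall x, d i x = j (p x)]].

End Torsionfree.

(* Main.v *)
Require Import Defs.
From HB Require Import structures.
From mathcomp Require Import freeg.
From mathcomp Require Import all_boot all_algebra.
From mathcomp Require Import boolp functions.

Set Implicit Arguments.
Unset Strict Implicit.
Unset Printing Implicit Defensive.

Import GRing.Theory.
Import Defs.
Local Open Scope ring_scope.
Local Open Scope quotient_scope.

(** Call f : M -> P a (left) projective approximation if P is projective and
    every map from M to a projective module factors through f. A finitely
    generated module M over a Noetherian ring is k-torsionfree if and only if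
    it has an approximation tower of height k: an approximation of M is
    injective, the approximation of its cokernel is injective, and so on k
    times ([torsionfree_approx_tower]). The reason is that the image of the
    dual of a presentation of M is both a syzygy of Tr M and a transpose of
    the cokernel of M -> R^n, when the coordinates of this map generate the
    dual of M.

    Towers do not depend on the chosen approximations ([approx_tower_indep]),
    and in a short exact sequence 0 -> C -> C' -> G -> 0, such that maps from
    C to projectives extend to C' and such that G has a tower, C has a tower
    if and only if C' has one ([approx_tower_extension]). Gorenstein
    projective modules have towers of every height.

    The theorem then follows from two facts, since both functors involved
    preserve short exact sequences and finite generation.
    - A finitely generated A-module N is k-torsionfree over A if and only if
      it is so over R ([restriction_approx_tower]). As Hom_R(A, R) is
      projective over A, an approximation N -> A^n over A, followed by an
      approximation A^n -> R^m over R, is an approximation over R; as A is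
      Gorenstein projective over R, the cokernel of A^n -> R^m has towers, so
      that the cokernels of N -> A^n and of N -> R^m have towers at the same
      time.
    - A finitely generated R-module M is k-torsionfree over R if and only if
      T (x)_R M is so over A ([base_change_approx_tower]). As Hom_A(T, A) is
      flat, maps M -> Hom_A(T, A) factor through projectives
      ([flat_factors_projective]), and this is what is needed for T (x) - to
      preserve approximations; it preserves and reflects injectivity because
      T is faithfully flat.
    The first fact carries extension closedness from R to A, the second one
    from A to R. *)

(** * Linear maps, submodules and quotients *)

Definition linear_of (S : pzRingType) (U V : lmodType S) (f : U -> V)
    (f_linear : linear f) : {linear U -> V} :=
  HB.pack_for {linear U -> V} f (GRing.isLinear.Build S U V *:%R f f_linear).

Definition short_exact (S : pzRingType) (U V W : lmodType S)
    (f : {linear U -> V}) (g : {linear V -> W}) :=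
  [/\ injective f, exact_at f g & surjective g].

Definition submodule (S : pzRingType) (M : lmodType S) (K : M -> Prop) :=
  K 0 /\ forall (a : S) x y, K x -> K y -> K (a *: x + y).

Lemma linear_inj (S : pzRingType) (U V : lmodType S) (f : {linear U -> V}) :
  (forall x, f x = 0 -> x = 0) -> injective f.
Proof.
by move=> f0 x y fxy; apply/subr0_eq/f0; rewrite linearB fxy subrr.
Qed.

Lemma linear_inj0 (S : pzRingType) (U V : lmodType S) (f : {linear U -> V}) x :
  injective f -> f x = 0 -> x = 0.
Proof. by move=> fi fx0; apply: fi; rewrite fx0 linear0. Qed.

Lemma exact_comp0 (S : pzRingType) (U V W : lmodType S)
    (f : {linear U -> V}) (g : {linear V -> W}) :
  exact_at f g -> forall x, g (f x) = 0.
Proof. by move=> fg x; apply/fg; exists x. Qed.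

Lemma linear_descend (S : pzRingType) (U V W : lmodType S)
    (q : {linear U -> V}) (h : {linear U -> W}) :
  surjective q -> (forall x, q x = 0 -> h x = 0) ->
  exists h' : {linear V -> W}, forall x, h' (q x) = h x.
Proof.
move=> qs qh; pose s v := projT1 (cid (qs v)).
have sK v : q (s v) = v by exact: projT2 (cid (qs v)).
have hq x y : q x = q y -> h x = h y.
  by move=> qxy; apply/subr0_eq; rewrite -linearB qh // linearB qxy subrr.
have hl : linear (h \o s).
  by move=> a x y /=; rewrite -linearP; apply: hq; rewrite linearP !sK.
by exists (linear_of hl) => x /=; apply: hq; rewrite sK.
Qed.

Section QuotientModule.
Variables (S : pzRingType) (M : lmodType S) (K : M -> Prop).
Hypothesis K_submodule : submodule K.

Definition submodule_pred : {pred M} := fun x => `[< K x >].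

Fact submodule_pred_zmod_closed : zmod_closed submodule_pred.
Proof.
case: K_submodule => K0 Klin; split=> [|x y /asboolP Kx /asboolP Ky].
  exact/asboolP.
by apply/asboolP; rewrite addrC -scaleN1r; exact: Klin.
Qed.

HB.instance Definition _ := GRing.isZmodClosed.Build M submodule_pred
  submodule_pred_zmod_closed.

Definition quotient_module : Type := Quotient.quot submodule_pred.
HB.instance Definition _ := GRing.Zmodule.on quotient_module.

Definition quotient_proj (x : M) : quotient_module :=
  \pi_(Quotient.quot submodule_pred) x.

Lemma quotient_proj_eq x y :
  quotient_proj x = quotient_proj y <-> K (x - y).
Proof.
split=> [/eqP|Kxy]; first by rewrite -Quotient.idealrBE => /asboolP.
by apply/eqP; rewrite -Quotient.idealrBE; exact/asboolP.
Qed.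

Lemma quotient_projD : {morph quotient_proj : x y / x + y}.
Proof. by move=> x y; rewrite /quotient_proj raddfD. Qed.

Definition quotient_scale (a : S) (v : quotient_module) : quotient_module :=
  quotient_proj (a *: repr v).

Lemma quotient_scale_proj a x :
  quotient_scale a (quotient_proj x) = quotient_proj (a *: x).
Proof.
apply/quotient_proj_eq; rewrite -scalerBr -[_ *: _]addr0.
have [K0 Klin] := K_submodule; apply: Klin => //.
by apply/quotient_proj_eq; rewrite /quotient_proj reprK.
Qed.

Lemma quotient_proj_surj v : exists x, quotient_proj x = v.
Proof. by exists (repr v); rewrite /quotient_proj reprK. Qed.

Fact quotient_scaleA a b v :
  quotient_scale a (quotient_scale b v) = quotient_scale (a * b) v.
Proof.
by have [x <-] := quotient_proj_surj v; rewrite !quotient_scale_proj scalerA.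
Qed.
Fact quotient_scale1 : left_id 1 quotient_scale.
Proof.
move=> v; have [x <-] := quotient_proj_surj v.
by rewrite quotient_scale_proj scale1r.
Qed.
Fact quotient_scaleDr : right_distributive quotient_scale +%R.
Proof.
move=> a v w; have [x <-] := quotient_proj_surj v.
have [y <-] := quotient_proj_surj w.
by rewrite -quotient_projD !quotient_scale_proj scalerDr quotient_projD.
Qed.
Fact quotient_scaleDl v : {morph quotient_scale^~ v : a b / a + b}.
Proof.
move=> a b; have [x <-] := quotient_proj_surj v.
by rewrite !quotient_scale_proj scalerDl quotient_projD.
Qed.
HB.instance Definition _ := GRing.Zmodule_isLmodule.Build S quotient_module
  quotient_scaleA quotient_scale1 quotient_scaleDr quotient_scaleDl.

Fact quotient_proj_linear : linear quotient_proj.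
Proof. by move=> a x y; rewrite quotient_projD -quotient_scale_proj. Qed.

Lemma exists_quotient :
  exists (C : lmodType S) (q : {linear M -> C}),
    surjective q /\ forall x, q x = 0 <-> K x.
Proof.
exists quotient_module, (linear_of quotient_proj_linear).
split=> [|x]; first exact: quotient_proj_surj.
have p0 : quotient_proj 0 = 0 := linear0 (linear_of quotient_proj_linear).
by rewrite -[X in K X]subr0 -p0; exact: quotient_proj_eq.
Qed.

End QuotientModule.

Lemma image_submodule (S : pzRingType) (U V : lmodType S)
  (f : {linear U -> V}) : submodule (fun v => exists u, f u = v).
Proof.
split=> [|a _ _ [x <-] [y <-]]; first by exists 0; rewrite linear0.
by exists (a *: x + y); rewrite linearP.
Qed.

Lemma kernel_submodule (S : pzRingType) (U V : lmodType S)
  (f : {linear U -> V}) : submodule (fun u => f u = 0).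
Proof.
by split=> [|a x y fx fy]; rewrite ?linear0 // linearP fx fy scaler0 addr0.
Qed.

Lemma exists_cokernel (S : pzRingType) (U V : lmodType S)
    (f : {linear U -> V}) :
  exists (C : lmodType S) (q : {linear V -> C}), exact_at f q /\ surjective q.
Proof.
by have [C [q [qs qK]]] := exists_quotient (image_submodule f); exists C, q.
Qed.

(** Images are quotients by kernels; in this form no submodule ever has to be
    turned into a module of its own. *)
Lemma exists_image (S : pzRingType) (U V : lmodType S) (f : {linear U -> V}) :
  exists (C : lmodType S) (q : {linear U -> C}) (j : {linear C -> V}),
    [/\ surjective q, injective j & forall x, j (q x) = f x].
Proof.
have [C [q [qs qK]]] := exists_quotient (kernel_submodule f).
have [j jq] := linear_descend qs (fun x => proj1 (qK x)).
exists C, q, j; split=> //; apply: linear_inj => c.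
by have [x <-] := qs c; rewrite jq => /qK.
Qed.

(** * Free, projective and finitely generated modules *)

Section FreeModules.
Variable S : pzRingType.

Lemma linear_comb (M : lmodType S) n (e : 'I_n -> M) :
  exists h : {linear 'rV[S]_n -> M},
    (forall v, h v = \sum_(i < n) v 0 i *: e i) /\
    (forall i, h (delta_mx 0 i) = e i).
Proof.
have hl : linear (fun v : 'rV[S]_n => \sum_(i < n) v 0 i *: e i).
  move=> a u v; rewrite scaler_sumr -big_split /=; apply: eq_bigr => i _.
  by rewrite !mxE scalerDl scalerA.
exists (linear_of hl); split=> // i /=.
rewrite (bigD1 i) //= mxE !eqxx scale1r big1 ?addr0 // => j ji.
by rewrite mxE (negPf ji) andbF scale0r.
Qed.

Lemma rV_linear_eq (M : lmodType S) n (f g : {linear 'rV[S]_n -> M}) :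
  (forall i, f (delta_mx 0 i) = g (delta_mx 0 i)) -> f =1 g.
Proof.
move=> fg v; rewrite [v]row_sum_delta !linear_sum; apply: eq_bigr => i _.
by rewrite !linearZ /= fg.
Qed.

Lemma rV_projective n : projective 'rV[S]_n.
Proof.
move=> M N g f gs.
pose e i := projT1 (cid (gs (f (delta_mx 0 i)))).
have eP i : g (e i) = f (delta_mx 0 i) by rewrite /e; case: cid.
have [h [_ he]] := linear_comb e; exists h => v.
by apply: (@rV_linear_eq _ _ (g \o h)) => i /=; rewrite he eP.
Qed.

Lemma rV_coord n (i : 'I_n) : exists h : {linear 'rV[S]_n -> S^o},
  forall v, h v = v 0 i.
Proof.
have hl : linear (fun v : 'rV[S]_n => v 0 i : S^o).
  by move=> a u v; rewrite !mxE.
by exists (linear_of hl).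
Qed.

Lemma linear_row (M : lmodType S) n (u : 'I_n -> {linear M -> S^o}) :
  exists h : {linear M -> 'rV[S]_n}, forall x i, h x 0 i = u i x.
Proof.
have hl : linear (fun x => \row_i (u i x) : 'rV[S]_n).
  by move=> a x y; apply/rowP => i; rewrite !mxE linearP.
by exists (linear_of hl) => x i; rewrite mxE.
Qed.

Lemma retract_projective (P Q : lmodType S) (i : {linear P -> Q})
    (r : {linear Q -> P}) :
  cancel i r -> projective Q -> projective P.
Proof.
move=> ir Qp M N g f gs; have [h hE] := Qp M N g (f \o r) gs.
by exists (h \o i) => x /=; rewrite hE /= ir.
Qed.

Lemma prod_projective (P Q : lmodType S) :
  projective P -> projective Q -> projective (P * Q)%type.
Proof.
move=> Pp Qp M N g f gs.
have l1 : linear (fun x : P => (x, 0 : Q)).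
  by move=> a x y; congr pair; rewrite /= scaler0 addr0.
have l2 : linear (fun x : Q => (0 : P, x)).
  by move=> a x y; congr pair; rewrite /= scaler0 addr0.
have [h1 h1E] := Pp M N g (f \o linear_of l1) gs.
have [h2 h2E] := Qp M N g (f \o linear_of l2) gs.
have hl : linear (fun z : P * Q => h1 z.1 + h2 z.2).
  by move=> a x y; rewrite !linearP /= scalerDr addrACA.
exists (linear_of hl) => -[x y] /=.
rewrite linearD h1E h2E /= -linearD; congr (f _).
by congr pair; rewrite /= ?addr0 ?add0r.
Qed.

Lemma finitely_generatedE (M : lmodType S) :
  finitely_generated M <->
  exists (n : nat) (h : {linear 'rV[S]_n -> M}), surjective h.
Proof.
split=> [[n [e ee]]|[n [h hs]]].
  have [h [hE _]] := linear_comb e; exists n, h => x.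
  have [c ->] := ee x; exists (\row_i c i).
  by rewrite hE; apply: eq_bigr => i _; rewrite mxE.
exists n, (fun i => h (delta_mx 0 i)) => x; have [v <-] := hs x.
exists (v 0); rewrite [v in LHS]row_sum_delta linear_sum.
by apply: eq_bigr => i _; rewrite linearZ.
Qed.

Lemma surj_finitely_generated (M N : lmodType S) (f : {linear M -> N}) :
  surjective f -> finitely_generated M -> finitely_generated N.
Proof.
move=> fs /finitely_generatedE[n [h hs]]; apply/finitely_generatedE.
exists n, (f \o h) => y; have [x <-] := fs y; have [v <-] := hs x.
by exists v.
Qed.

Lemma rV_finitely_generated n : finitely_generated 'rV[S]_n.
Proof. by apply/finitely_generatedE; exists n, idfun => v; exists v. Qed.

Lemma fg_projective_retract (P : lmodType S) :
  fg_projective P ->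
  exists (n : nat) (i : {linear P -> 'rV[S]_n}) (r : {linear 'rV[S]_n -> P}),
    cancel i r.
Proof.
move=> [/finitely_generatedE[n [r rs]] Pp].
have [i ri] := Pp _ _ r (idfun : {linear P -> P}) rs.
by exists n, i, r.
Qed.

End FreeModules.

(** A stand-in for the free module on the set Q. Since each family of
    coefficients g : Q -> S is paired with the value y of sum_q g(q) q, the
    surjection onto Q is a projection, and the sum need not be defined: it is
    only required to be y over all large enough finite sets. *)
Section Combinations.
Variables (S : pzRingType) (Q : lmodType S).

Definition combination_pred : {pred (Q -> S^o) * Q} := fun z =>
  `[< exists L : seq Q, forall L', uniq L' -> {subset L <= L'} ->
      z.2 = \sum_(q <- L') (z.1 q : S) *: q >].

Fact combination_submod_closed : submod_closed combination_pred.
Proof.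
split=> [|a z w /asboolP[L zL] /asboolP[L' wL]]; apply/asboolP.
  by exists [::] => L' _ _; rewrite big1_seq // => q _; exact: scale0r.
exists (L ++ L') => L'' uL sL; rewrite [LHS]/= (zL L'') //; last first.
  by move=> q qL; apply: sL; rewrite mem_cat qL.
rewrite (wL L'') //; last by move=> q qL; apply: sL; rewrite mem_cat qL orbT.
rewrite scaler_sumr -big_split /=; apply: eq_bigr => q _.
by rewrite scalerA -scalerDl.
Qed.

HB.instance Definition _ := GRing.isSubmodClosed.Build S ((Q -> S^o) * Q)%type
  combination_pred combination_submod_closed.

Definition combination : Type := {z : (Q -> S^o) * Q | combination_pred z}.
HB.instance Definition _ := [isSub of combination for @sval _ _].
HB.instance Definition _ := [Choice of combination by <:].
HB.instance Definition _ := [SubChoice_isSubLmodule of combination by <:].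

End Combinations.

(** Combinations project onto Q, so Q projective gives a section, that is,
    linear coordinates on Q. Finitely many generators of M need only a finite
    set L of elements of Q to be recovered from these coordinates, hence so
    does M. *)
Lemma fg_to_projective (S : pzRingType) (M Q : lmodType S)
    (f : {linear M -> Q}) :
  finitely_generated M -> projective Q ->
  exists (n : nat) (v : {linear M -> 'rV[S]_n}) (w : {linear 'rV[S]_n -> Q}),
    forall x, w (v x) = f x.
Proof.
move=> /finitely_generatedE[m [e es]] Qp.
have sl : linear (fun z : combination Q => (val z).2) by move=> a x y.
have ss : surjective (linear_of sl).
  move=> y; have yP : combination_pred ((fun q => (q == y)%:R : S^o), y).
    apply/asboolP; exists [:: y] => L uL /(_ y (mem_head _ _)) yL /=.
    rewrite (bigD1_seq y) //= eqxx scale1r big1 ?addr0 // => q /negPf ->.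
    exact: scale0r.
  by exists (Sub _ yP).
have [s sK] := Qp _ _ (linear_of sl) (idfun : {linear Q -> Q}) ss.
pose g i := e (delta_mx 0 i).
have LP i := asboolP _ (valP (s (f (g i)))).
pose Ls i := projT1 (cid (LP i)).
pose L := undup (flatten [seq Ls i | i <- enum 'I_m]).
have LE i : f (g i) = \sum_(q <- L) ((val (s (f (g i)))).1 q : S) *: q.
  rewrite -{1}[f (g i)]sK /=.
  apply: (projT2 (cid (LP i))); rewrite ?undup_uniq //.
  move=> q qL; rewrite mem_undup; apply/flattenP; exists (Ls i) => //.
  by apply: map_f; rewrite mem_enum.
have cl q : linear (fun z : combination Q => (val z).1 q : S^o).
  by move=> a x y.
have [v vE] := linear_row
  (fun j : 'I_(size L) => linear_of (cl (nth 0 L j)) \o s \o f).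
have [w [wE _]] := linear_comb (fun j : 'I_(size L) => nth 0 L j).
exists (size L), v, w => x; have [c <-] := es x.
apply: (@rV_linear_eq _ _ _ (w \o v \o e) (f \o e)) => i /=.
rewrite wE [RHS]LE (big_nth 0) big_mkord; apply: eq_bigr => j _.
by rewrite vE.
Qed.

(** * Towers of projective approximations *)

Section Approximations.
Variable S : pzRingType.
Implicit Types M P Q C D E G X : lmodType S.

Definition extends_to_projectives M P (f : {linear M -> P}) :=
  forall Q, projective Q -> forall h : {linear M -> Q},
    exists h' : {linear P -> Q}, forall x, h' (f x) = h x.

Definition approximation M P (f : {linear M -> P}) :=
  projective P /\ extends_to_projectives f.

(** Torsionfreeness read off from M instead of its transpose: k times in a row,
    an approximation is injective and is replaced by its cokernel. The modules P
    are not required to be finitely generated, so that the syzygies of an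
    arbitrary complete resolution qualify. *)
Fixpoint approx_tower (k : nat) (M : lmodType S) : Prop :=
  if k is k'.+1 then
    exists P C (f : {linear M -> P}) (g : {linear P -> C}),
      [/\ approximation f, short_exact f g & approx_tower k' C]
  else True.

Lemma linear_pair M P Q (f : {linear M -> P}) (g : {linear M -> Q}) :
  exists h : {linear M -> (P * Q)%type}, forall x, h x = (f x, g x).
Proof.
have hl : linear (fun x => (f x, g x)) by move=> a x y; rewrite !linearP.
by exists (linear_of hl).
Qed.

Lemma linear_copair M P Q (f : {linear P -> M}) (g : {linear Q -> M}) :
  exists h : {linear (P * Q)%type -> M}, forall z, h z = f z.1 + g z.2.
Proof.
have hl : linear (fun z : P * Q => f z.1 + g z.2).
  by move=> a x y; rewrite !linearP /= scalerDr addrACA.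
by exists (linear_of hl).
Qed.

Lemma linear_left C Q : exists i : {linear C -> (C * Q)%type},
  forall x, i x = (x, 0).
Proof.
exact: (linear_pair (idfun : {linear C -> C}) (\0 : {linear C -> Q})).
Qed.

Lemma linear_right C Q : exists i : {linear Q -> (C * Q)%type},
  forall x, i x = (0, x).
Proof.
exact: (linear_pair (\0 : {linear Q -> C}) (idfun : {linear Q -> Q})).
Qed.

Lemma approx_tower_iso k C D (i : {linear D -> C}) :
  injective i -> surjective i -> approx_tower k C -> approx_tower k D.
Proof.
move=> ii is_; case: k => //= k [P [E [f [g [[Pp fa] [fi fg gs] Et]]]]].
have [j jK] : exists j : {linear C -> D}, forall x, j (i x) = x.
  by apply: (linear_descend (h := idfun) is_) => x /(linear_inj0 ii).
exists P, E, (f \o i), g; split=> //.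
- split=> // Q Qp h; have [h' h'E] := fa Q Qp (h \o j).
  by exists h' => x /=; rewrite h'E /= jK.
- split=> // [x y /= /fi/ii //|p]; split=> [/fg[c <-]|[d <-]].
    by have [d <-] := is_ c; exists d.
  exact: exact_comp0 fg (i d).
Qed.

(** The form in which uniqueness of cokernels gets used: no isomorphism between
    C and D needs to be produced. *)
Lemma approx_tower_coker k (U C D : lmodType S) (u : {linear U -> C})
    (v : {linear U -> D}) :
  surjective u -> surjective v -> (forall x, u x = 0 <-> v x = 0) ->
  approx_tower k C -> approx_tower k D.
Proof.
move=> us vs uv; have [i iE] := linear_descend vs (fun x => proj2 (uv x)).
apply: (@approx_tower_iso _ _ _ i) => [|c].
  apply: linear_inj => d; have [x <-] := vs d.
  by rewrite iE => /uv.
by have [x <-] := us c; exists (v x).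
Qed.

Lemma approx_tower_prod k C Q :
  projective Q -> approx_tower k C -> approx_tower k (C * Q)%type.
Proof.
move=> Qp; case: k => //= k [P [E [f [g [[Pp fa] [fi fg gs] Et]]]]].
have [f' f'E] := linear_pair (f \o fst : {linear (C * Q)%type -> P})
  (snd : {linear (C * Q)%type -> Q}).
exists (P * Q)%type, E, f', (g \o fst); split=> //.
- split=> [|X Xp h]; first exact: prod_projective.
  have [i iE] := linear_left C Q; have [j jE] := linear_right C Q.
  have [h1 h1E] := fa X Xp (h \o i).
  have [h' h'E] := linear_copair h1 (h \o j); exists h' => -[c q].
  rewrite h'E f'E /= h1E /= iE jE -linearD; congr (h _).
  by congr pair; rewrite /= ?addr0 ?add0r.
- split=> [||y]; last by have [p <-] := gs y; exists (p, 0).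
    by move=> [c q] [c' q']; rewrite !f'E => -[/fi -> ->].
  move=> [p q] /=; split=> [/fg[c <-]|[[c q'] ]]; first by exists (c, q).
  by rewrite f'E => -[<- _]; exact: exact_comp0 fg c.
Qed.

(** An approximation f : C * Q -> P has a retraction r : P -> Q with
    r (f (c, y)) = y, so that f (0, -) splits off from P. What remains, the
    cokernel P' of f (0, -), approximates C with the same cokernel as f. *)
Lemma approx_tower_prodK k C Q :
  projective Q -> approx_tower k (C * Q)%type -> approx_tower k C.
Proof.
move=> Qp; case: k => //= k [P [E [f [g [[Pp fa] [fi fg gs] Et]]]]].
have [i iE] := linear_left C Q; have [j jE] := linear_right C Q.
have [r rE] := fa Q Qp (snd : {linear (C * Q)%type -> Q}).
have [P' [q [fjq qs]]] := exists_cokernel (f \o j).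
have q0 y : q (f (j y)) = 0 by exact: exact_comp0 fjq y.
have [s sE] : exists s : {linear P' -> P}, forall p, s (q p) = p - f (j (r p)).
  apply: (linear_descend (h := idfun \- (f \o j \o r)) qs) => p.
  by move=> /fjq[y <-] /=; rewrite rE jE /= -jE subrr.
have [g' g'E] : exists g' : {linear P' -> E}, forall p, g' (q p) = g p.
  by apply: linear_descend => // p /fjq[y <-]; exact: exact_comp0 fg (j y).
exists P', E, (q \o f \o i), g'; split=> //.
- split=> [|X Xp h].
    apply: (@retract_projective _ P' P s q) => // p'.
    by have [p <-] := qs p'; rewrite sE linearB q0 subr0.
  have [h1 h1E] := fa X Xp (h \o fst).
  have [h' h'E] : exists h' : {linear P' -> X}, forall p, h' (q p) = h1 p.
    apply: linear_descend => // p /fjq[y <-] /=.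
    by rewrite h1E /= jE linear0.
  by exists h' => c /=; rewrite h'E h1E /= iE.
split=> [|p'|y]; last by have [p <-] := gs y; exists (q p).
- apply: linear_inj => c /= /fjq[y] /fi.
  by rewrite iE jE => -[].
- have [p <-] := qs p'; rewrite g'E; split=> [/fg[[c y] <-]|[c] /=].
    exists c => /=; rewrite -[RHS]subr0 -(q0 y) -linearB -linearB iE jE.
    by congr (q (f _)); congr pair; rewrite /= ?subr0 ?subrr.
  by rewrite -g'E => <-; rewrite g'E; exact: exact_comp0 fg _.
Qed.

(** Schanuel's argument: for two approximations f : M -> P and g : M -> Q, the
    automorphisms of P * Q provided by the factorizations of f and g through
    each other identify both (coker f) * Q and P * (coker g) with the cokernel
    of the map x |-> (f x, 0). *)
Lemma approx_tower_indep k M Q (g : {linear M -> Q}) :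
  approx_tower k.+1 M -> approximation g ->
  injective g /\
  forall D (p : {linear Q -> D}), exact_at g p -> surjective p ->
    approx_tower k D.
Proof.
move=> [P [C [f [u [[Pp fa] [fi fu us] Ct]]]]] [Qp ga].
have [h hE] := fa Q Qp g; have [h' h'E] := ga P Pp f.
split=> [x y gxy|D p gp ps]; first by apply: fi; rewrite -!h'E gxy.
apply: (approx_tower_prodK Pp).
have [v1 v1E] := linear_pair (u \o fst : {linear (P * Q)%type -> C})
  (snd : {linear (P * Q)%type -> Q}).
pose t : {linear (P * Q)%type -> Q} := snd \+ (h \o fst).
have [v2 v2E] := linear_pair (p \o t) (fst \- (h' \o t)).
apply: (@approx_tower_coker _ _ _ _ v1 v2); last exact: approx_tower_prod.
- move=> [c q]; have [x <-] := us c; exists (x, q).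
  by rewrite v1E.
- move=> [d x]; have [q <-] := ps d; pose y := x + h' q.
  exists (y, q - h y); rewrite v2E /= subrK; congr pair.
  by rewrite /y addrK.
- move=> [x q]; rewrite v1E v2E /=; split=> [[/fu[m <-] ->]|[]].
    rewrite add0r hE h'E subrr; congr pair; exact: exact_comp0 gp m.
  move=> /gp[m mE]; rewrite -mE h'E => /subr0_eq xE.
  have: q + h x = g m by [].
  rewrite xE hE => /(canRL (addrK _)); rewrite subrr => ->.
  by congr pair; exact: exact_comp0 fu m.
Qed.

(** The horseshoe construction: approximations of C and G assemble into one of
    C', and the resulting sequence of cokernels again satisfies the hypotheses.
    In the other direction the composite of C -> C' with an approximation of C'
    serves as approximation of C. *)
Lemma approx_tower_extension k C C' G (i : {linear C -> C'})
    (p : {linear C' -> G}) :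
  short_exact i p -> extends_to_projectives i -> approx_tower k G ->
  approx_tower k C <-> approx_tower k C'.
Proof.
elim: k C C' G i p => // k IH C C' G i p [ii ip ps] ia Gt.
have [Q [E [b [w [[Qp ba] [bi bw ws] Et]]]]] := Gt.
(* With e extending a to C', the map f = (e, b p) approximates C' and the
   induction hypothesis applies to the sequence of cokernels of a, f and b. *)
suff step P (a : {linear C -> P}) (e : {linear C' -> P}) :
    approximation a -> (forall x, e (i x) = a x) -> injective a ->
    exists (f : {linear C' -> (P * Q)%type}),
      [/\ approximation f, injective f &
       forall D D' (u : {linear P -> D}) (v : {linear (P * Q)%type -> D'}),
         exact_at a u -> surjective u -> exact_at f v -> surjective v ->
         approx_tower k D <-> approx_tower k D'].
  split=> [[P [D [a [u [aa [ai au us] Dt]]]]]|C't].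
    have [e eE] := ia P (proj1 aa) a.
    have [f [fa fi fD]] := step P a e aa eE ai.
    have [D' [v [fv vs]]] := exists_cokernel f.
    exists (P * Q)%type, D', f, v; split=> //.
    by apply/(fD D D' u v).
  have [P [D' [e [v [[Pp ea] [ei ev vs] D't]]]]] := C't.
  have aa : approximation (e \o i).
    split=> // X Xp h; have [h1 h1E] := ia X Xp h; have [h2 h2E] := ea X Xp h1.
    by exists h2 => x /=; rewrite h2E h1E.
  have ai : injective (e \o i) by move=> x y /ei/ii.
  have [f [fa fi fD]] := step P _ e aa (fun=> erefl) ai.
  have [D [u [au us]]] := exists_cokernel (e \o i).
  have [D1 [v1 [fv1 vs1]]] := exists_cokernel f.
  exists P, D, (e \o i), u; split=> //.
  apply/(fD D D1 u v1) => //.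
  by have [_] := approx_tower_indep C't fa; apply.
move=> [Pp aa] eE ai.
have [f fE] := linear_pair e (b \o p).
have p0 x : p (i x) = 0 by exact: exact_comp0 ip x.
exists f; split.
- split=> [|X Xp h]; first exact: prod_projective.
  have [h1 h1E] := aa X Xp (h \o i).
  have [h2 h2E] : exists h2 : {linear G -> X},
      forall x, h2 (p x) = h x - h1 (e x).
    apply: (linear_descend (h := h \- (h1 \o e)) ps) => x /ip[c <-] /=.
    by rewrite eE h1E subrr.
  have [h3 h3E] := ba X Xp h2.
  have [h' h'E] := linear_copair h1 h3; exists h' => x.
  by rewrite h'E fE /= h3E h2E addrC subrK.
- apply: linear_inj => x; rewrite fE => -[ex0 /(linear_inj0 bi)/ip[c xc]].
  by move: ex0; rewrite -xc eE => /(linear_inj0 ai) ->; rewrite linear0.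
move=> D D' u v au us fv vs.
have [l lE] := linear_left P Q.
have [i' i'E] : exists i' : {linear D -> D'}, forall x, i' (u x) = v (l x).
  apply: (linear_descend (h := v \o l) us) => _ /au[c <-].
  apply/fv; exists (i c); rewrite fE /= eE p0 linear0; exact/esym/lE.
have [p' p'E] : exists p' : {linear D' -> E}, forall z, p' (v z) = w z.2.
  apply: (linear_descend (h := w \o snd) vs) => z /fv[c <-].
  by rewrite fE /=; exact: exact_comp0 bw _.
apply: (IH D D' E i' p') => //.
  split=> [|d'|y].
  - apply: linear_inj => d; have [x <-] := us d.
    rewrite i'E lE => /fv[c]; rewrite fE => -[ecx /(linear_inj0 bi)/ip[c' cE]].
    by apply/au; exists c'; rewrite -ecx -cE eE.
  - have [[x q] <-] := vs d'; rewrite p'E /=; split=> [/bw[y yq]|[d]].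
      have [c' c'y] := ps y; exists (u (x - e c')).
      apply/esym/subr0_eq; rewrite i'E lE -linearB; apply/fv; exists c'.
      rewrite fE /= c'y yq; congr pair; last by rewrite /= subr0.
      by rewrite /= opprB addrC subrK.
    have [x' <-] := us d; rewrite i'E => vE.
    by rewrite -[w q](p'E (x, q)) -vE p'E lE linear0.
  - by have [q <-] := ws y; exists (v (0, q)); rewrite p'E.
move=> X Xp h.
have [t tE] : exists t : {linear G -> X}, forall x, t (p x) = h (u (e x)).
  apply: (linear_descend (h := h \o u \o e) ps) => x /ip[c <-] /=.
  by rewrite eE (exact_comp0 au) linear0.
have [t' t'E] := ba X Xp t.
have [h1 h1E] := linear_copair (h \o u) (\- t' : {linear Q -> X}).
have [h' h'E] : exists h' : {linear D' -> X}, forall z, h' (v z) = h1 z.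
  by apply: linear_descend => // z /fv[c <-]; rewrite h1E fE /= t'E tE subrr.
exists h' => d; have [x <-] := us d.
by rewrite i'E h'E h1E lE /= linear0 oppr0 addr0.
Qed.

End Approximations.

Lemma projective_approx_tower (S : pzRingType) k (P : lmodType S) :
  projective P -> approx_tower k P.
Proof.
elim: k P => //= k IH P Pp; have Z0 (z : 'rV[S]_0) : z = 0.
  by apply/rowP; case.
exists P, 'rV[S]_0, idfun, \0; split; [|split|exact/IH/rV_projective].
- by split=> // Q Qp h; exists h.
- by [].
- by move=> p; split=> // _; exists p.
- by move=> z; exists 0; rewrite [z]Z0.
Qed.

(** In a complete resolution each image M of a differential embeds in the next
    term with the next image as cokernel, and exactness of Hom(-, Q) says that
    this embedding is an approximation. *)
Lemma Gorenstein_projective_approx_tower (S : pzRingType) k (M : lmodType S) :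
  Gorenstein_projective M -> approx_tower k M.
Proof.
move=> [P [d [Pp dE dQ [i [p [j [ps ji dpj]]]]]]].
elim: k M i p j ps ji dpj => //= k IH M i p j ps ji dpj.
have [C [q [j' [qs j'i q'E]]]] := exists_image (d (i + 1)).
have jq : exact_at j q.
  move=> x; split=> [qx0|[m <-]].
    have : d (i + 1) x = 0 by rewrite -q'E qx0 linear0.
    by move=> /dE[y <-]; exists (p y); rewrite dpj.
  have [y <-] := ps m; apply: j'i; rewrite linear0 q'E -dpj.
  exact: (exact_comp0 (dE i)).
exists (P (i + 1)), C, j, q; split; last exact: (IH C (i + 1) q j').
  split=> // Q Qp h.
  (* Write i as i' + 1, so that the differential into P i is d i'. *)
  pose i' := i - 1; have ii' : i = i' + 1 by rewrite subrK.
  move: i' ii' p j ps ji dpj {C q j' qs j'i q'E jq} => i' ->.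
  move=> p j ps ji dpj.
  pose hp : Hom (P (i' + 1)) Q := (h \o p : {linear P (i' + 1) -> Q}).
  have [u uE] : exists u, precomp (Q := Q) (d (i' + 1)) u = hp.
    apply/(dQ Q Qp i')/Hom_ext => x; rewrite /precomp /hp /=.
    suff -> : p (d i' x) = 0 by rewrite linear0.
    by apply: ji; rewrite -dpj linear0; exact: (exact_comp0 (dE i')).
  exists u => m; have [x <-] := ps m; rewrite -dpj.
  exact: (congr1 (fun f : Hom _ _ => f x) uE).
by [].
Qed.

(** * Noetherian rings *)

Section LeftSpan.
Variables (S : pzRingType) (M : lmodType S).
Implicit Types (e : seq M) (x : M) (K : M -> Prop).

Fixpoint lspan e x : Prop :=
  if e is y :: e' then exists a : S, lspan e' (x - a *: y) else x = 0.

Lemma lspan_submodule e : submodule (lspan e).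
Proof.
elim: e => [|y e [K0 Klin]] /=.
  by split=> // a x y -> ->; rewrite scaler0 addr0.
split=> [|a u v [b ub] [c vc]]; first by exists 0; rewrite scale0r subr0.
exists (a * b + c); have := Klin a _ _ ub vc.
by rewrite scalerBr addrACA -opprD scalerA -scalerDl.
Qed.

Lemma lspan_min K e : submodule K -> {in e, forall y, K y} ->
  forall x, lspan e x -> K x.
Proof.
move=> [K0 Klin]; elim: e => [_ x -> //|y e IH] Ke x /= [a xa].
rewrite -[x](subrK (a *: y)) addrC; apply: Klin; first exact/Ke/mem_head.
by apply: IH xa => z ze; apply: Ke; rewrite inE ze orbT.
Qed.

Lemma lspan_mem e : {in e, forall y, lspan e y}.
Proof.
elim: e => // y e IH z; rewrite inE => /predU1P[->|ze] /=.
  by exists 1; rewrite scale1r subrr; exact: proj1 (lspan_submodule e).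
by exists 0; rewrite scale0r subr0; exact: IH.
Qed.

Lemma lspan_comb e x : lspan e x <->
  exists c : 'I_(size e) -> S, x = \sum_(i < size e) c i *: nth 0 e i.
Proof.
split=> [|[c ->]].
  elim: e x => [x ->|y e IH x /= [a /IH[c xE]]].
    by exists (fun=> 0); rewrite big_ord0.
  exists (fun i => if unlift ord0 i is Some j then c j else a).
  rewrite big_ord_recl unlift_none /= -[x in LHS](subrK (a *: y)) addrC xE.
  by congr (_ + _); apply: eq_bigr => i _; rewrite liftK.
have [K0 Klin] := lspan_submodule e.
elim/big_ind: _ => [//|u v|i _]; first by rewrite -{2}[u]scale1r; exact: Klin.
by rewrite -[_ *: _]addr0; apply: Klin => //; apply/lspan_mem/mem_nth.
Qed.

End LeftSpan.

Lemma finitely_generated_lspan (S : pzRingType) (M : lmodType S) :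
  finitely_generated M <-> exists e : seq M, forall x, lspan e x.
Proof.
split=> [[n [e eE]]|[e eE]]; last first.
  by exists (size e), (fun i => nth 0 e i) => x; apply/lspan_comb/eE.
exists [seq e i | i <- enum 'I_n] => x; have [c ->] := eE x.
have [K0 Klin] := lspan_submodule [seq e i | i <- enum 'I_n].
elim/big_ind: _ => [//|u v|i _]; first by rewrite -{2}[u]scale1r; exact: Klin.
rewrite -[_ *: _]addr0; apply: Klin => //; apply/lspan_mem/map_f.
by rewrite mem_enum.
Qed.

Definition submodules_fg (S : pzRingType) (M : lmodType S) :=
  forall K : M -> Prop, submodule K -> exists e, forall x, K x <-> lspan e x.

(** From a submodule K that is not finitely generated, keep choosing elements of
    K outside the span of the previous ones: the spans never stabilize. *)
Lemma noetherian_submodules_fg (S : pzRingType) (M : lmodType S) :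
  noetherian_module M -> submodules_fg M.
Proof.
move=> accM K Ksub; apply: contrapT => Knfg.
have next (e : seq M) : {in e, forall y, K y} -> exists y, K y /\ ~ lspan e y.
  move=> eK; apply: contrapT => nex; apply: Knfg; exists e => x.
  split=> [Kx|]; last exact: lspan_min.
  by apply: contrapT => nx; apply: nex; exists x.
pose nxt (e : seq M) : M :=
  if pselect {in e, forall y, K y} is left eK then projT1 (cid (next e eK))
  else 0.
pose c n := iter n (fun e => nxt e :: e) [::].
have cK n : {in c n, forall y, K y}.
  elim: n => // n IH y /=; rewrite inE => /predU1P[->|/IH //].
  rewrite /nxt; case: pselect => // eK; by case: (cid _) => z [].
have nxtN n : ~ lspan (c n) (nxt (c n)).
  by rewrite /nxt; case: pselect => // eK; case: (cid _) => z [].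
have [|n x|m mE] := accM (fun n x => `[< lspan (c n) x >]).
- move=> n; have [K0 Klin] := lspan_submodule (c n); split; first exact/asboolP.
  by move=> a x y /asboolP xP /asboolP yP; apply/asboolP/Klin.
- move=> /asboolP xc; apply/asboolP => /=.
  by exists 0; rewrite scale0r subr0.
have := mE m.+1 (leqnSn m) (nxt (c m)); rewrite !unfold_in => E.
apply: (nxtN m); apply/asboolP; rewrite -E; apply/asboolP.
exact/lspan_mem/mem_head.
Qed.

Section NoetherianRing.
Variable S : pzRingType.
Hypothesis S_noetherian : submodules_fg S^o.

(** Induction on a list spanning K, here y :: e: the coefficients of y form a
    left ideal I, finitely generated by assumption; lifts f of its generators
    to K, together with generators e1 of the part of K spanned by e, generate
    K. *)
Lemma fg_submodules_fg (M : lmodType S) :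
  finitely_generated M -> submodules_fg M.
Proof.
move=> /finitely_generated_lspan[e eM] K Ksub.
have {eM} : forall x, K x -> lspan e x by [].
elim: e K Ksub => [|y e IH] K Ksub Ke.
  by exists [::] => x; split=> [/Ke //|->]; case: Ksub.
have [K0 Klin] := Ksub.
pose I (a : S^o) := exists x, K x /\ lspan e (x - (a : S) *: y).
have Isub : submodule I.
  have [e0 elin] := lspan_submodule e; split.
    by exists 0; rewrite scale0r subr0.
  move=> b a a' [x [Kx xe]] [x' [Kx' xe']]; exists (b *: x + x').
  split; first exact: Klin.
  have := elin b _ _ xe xe'.
  by rewrite scalerBr addrACA -opprD scalerA -scalerDl.
have [g gI] := S_noetherian Isub.
have [e1 e1E] : exists e1, forall x, K x /\ lspan e x <-> lspan e1 x.
  apply: IH => [|x []//]; have [e0 elin] := lspan_submodule e.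
  by split=> // a u v [Ku ue] [Kv ve]; split; [exact: Klin|exact: elin].
have [f fE] : exists f : seq M, {in f, forall z, K z} /\
    forall a, lspan g a -> exists x, lspan f x /\ lspan e (x - (a : S) *: y).
  have gI' : {in g, forall a, I a} by move=> a /lspan_mem/gI.
  elim: (g) gI' => [_|a g' IHg gI'].
    exists [::]; split=> // a ->; exists 0; split=> //.
    by rewrite scale0r subr0; exact: proj1 (lspan_submodule e).
  have [x [Kx xe]] := gI' a (mem_head _ _).
  have [|f [fK fg]] := IHg.
    by move=> b bg; apply: gI'; rewrite inE bg orbT.
  exists (x :: f); split=> [z|b /= [c /fg[x' [fx' ex']]]].
    by rewrite inE => /predU1P[->|/fK].
  exists (c *: x + x'); split; first by exists c; rewrite addrC addKr.
  have bE : c * (a : S) + (b - c *: a) = b :> S.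
    by rewrite addrC; exact: subrK.
  have := proj2 (lspan_submodule e) c _ _ xe ex'.
  by rewrite scalerBr addrACA -opprD scalerA -scalerDl bE.
have [fK fg] := fE; have [s0 slin] := lspan_submodule (f ++ e1).
exists (f ++ e1) => x; split=> [Kx|]; last first.
  apply: lspan_min => // z; rewrite mem_cat => /orP[/fK //|].
  by move=> /lspan_mem/e1E[].
have [a xa] := Ke x Kx; have [|z [fz za]] := fg a; first by apply/gI; exists x.
have Kz : K z by exact: lspan_min fz.
have x_z : lspan e1 (x - z).
  apply/e1E; split; first by rewrite addrC -scaleN1r; exact: Klin.
  have := proj2 (lspan_submodule e) (-1) _ _ za xa.
  by rewrite scaleN1r opprB addrC addrA subrK.
rewrite -[x](subrK z) addrC -{1}[z]scale1r; apply: slin; last first.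
  apply: (lspan_min (lspan_submodule _)) x_z => w we.
  by apply: lspan_mem; rewrite mem_cat we orbT.
apply: (lspan_min (lspan_submodule _)) fz => w wf.
by apply: lspan_mem; rewrite mem_cat wf.
Qed.

Lemma injective_fg (M N : lmodType S) (f : {linear M -> N}) :
  injective f -> finitely_generated N -> finitely_generated M.
Proof.
move=> fi /fg_submodules_fg/(_ _ (image_submodule f))[e eE].
have [s sE] : exists s : seq M, e = map f s.
  have : {in e, forall y, exists x, f x = y} by move=> y /lspan_mem/eE.
  elim: e {eE} => [_|y e IH eI]; first by exists [::].
  have [x <-] := eI y (mem_head _ _).
  have [|s ->] := IH; first by move=> z ze; apply: eI; rewrite inE ze orbT.
  by exists (x :: s).
apply/finitely_generated_lspan; exists s => x.
have /eE : exists x', f x' = f x by exists x.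
rewrite sE; elim: (s) x => [x /=|y s' IH x /= [a]].
  exact: linear_inj0.
by rewrite -linearZ -linearB => /IH; exists a.
Qed.

Lemma exists_free_cover_of_kernel (M : lmodType S) n
    (f : {linear 'rV[S]_n -> M}) :
  exists m (h : {linear 'rV[S]_m -> 'rV[S]_n}), exact_at h f.
Proof.
have [e eE] :=
  fg_submodules_fg (rV_finitely_generated S n) (kernel_submodule f).
have [h [hE _]] := linear_comb (fun i : 'I_(size e) => nth 0 e i).
exists (size e), h => v; split=> [/eE/lspan_comb[c ->]|[u <-]].
  by exists (\row_i c i); rewrite hE; apply: eq_bigr => i _; rewrite mxE.
by apply/eE/lspan_comb; exists (u 0); rewrite hE.
Qed.

Lemma fg_presentation (M : lmodType S) : finitely_generated M ->
  exists m n (h : {linear 'rV[S]_m -> 'rV[S]_n}) (p : {linear 'rV[S]_n -> M}),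
    exact_at h p /\ surjective p.
Proof.
move=> /finitely_generatedE[n [p ps]].
by have [m [h hp]] := exists_free_cover_of_kernel p; exists m, n, h, p.
Qed.

(** The state of the construction of a resolution. Each new map is built with
    the previous domain as codomain, so that consecutive maps compose on the
    nose. *)
Record free_map_data := FreeMapData {
  fm_dom : nat;
  fm_cod : nat;
  fm_map : {linear 'rV[S]_fm_dom -> 'rV[S]_fm_cod}
}.

Lemma exists_projective_resolution (M : lmodType S) : finitely_generated M ->
  exists (P : nat -> lmodType S) (d : forall n, {linear P n.+1 -> P n})
    (eps : {linear P 0%N -> M}), projective_resolution d eps.
Proof.
move=> /fg_presentation[m [n [h [p [hp ps]]]]].
pose next_dom s := projT1 (cid (exists_free_cover_of_kernel (fm_map s))).
pose next_map s :
    {linear 'rV[S]_(next_dom s) -> 'rV[S]_(fm_dom s)} :=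
  projT1 (cid (projT2 (cid (exists_free_cover_of_kernel (fm_map s))))).
have next_exact s : exact_at (next_map s) (fm_map s).
  exact: projT2 (cid (projT2 (cid (exists_free_cover_of_kernel (fm_map s))))).
pose st := fix st i :=
  if i is i'.+1 then FreeMapData (next_map (st i')) else FreeMapData h.
exists (fun i => 'rV[S]_(fm_cod (st i)) : lmodType S).
exists (fun i => fm_map (st i)), p.
split=> //= [i|i]; first exact: rV_projective.
exact: next_exact.
Qed.

End NoetherianRing.

(** * Vanishing of Ext *)

Section Ext.
Variable S : pzRingType.

Lemma linear_factor_injective (U C V : lmodType S) (h : {linear U -> V})
    (j : {linear C -> V}) :
  injective j -> (forall x, exists c, j c = h x) ->
  exists h' : {linear U -> C}, forall x, j (h' x) = h x.
Proof.
move=> ji hj; pose k x := projT1 (cid (hj x)).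
have kE x : j (k x) = h x by rewrite /k; case: cid.
have kl : linear k by move=> a x y; apply: ji; rewrite linearP !kE linearP.
by exists (linear_of kl).
Qed.

Lemma projective_lift (P U V W : lmodType S) (f : {linear U -> V})
    (g : {linear V -> W}) (h : {linear P -> V}) :
  projective P -> exact_at f g -> (forall x, g (h x) = 0) ->
  exists h' : {linear P -> U}, forall x, f (h' x) = h x.
Proof.
move=> Pp fg gh; have [C [q [j [qs ji jq]]]] := exists_image f.
have [|h0 h0E] := linear_factor_injective (h := h) ji.
  by move=> x; have /fg[u uE] := gh x; exists (q u); rewrite jq.
have [h' h'E] := Pp _ _ q h0 qs.
by exists h' => x; rewrite -jq h'E h0E.
Qed.

(** The cohomology of Hom(P, Q) vanishes in degree j + 1. *)
Definition coboundaries_exact (Q : lmodType S) (P : nat -> lmodType S)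
    (d : forall n, {linear P n.+1 -> P n}) j :=
  forall v : {linear P j.+1 -> Q}, (forall x, v (d j.+1 x) = 0) ->
    exists u : {linear P j -> Q}, forall x, u (d j x) = v x.

Lemma coboundaries_exactE (Q : lmodType S) (P : nat -> lmodType S)
    (d : forall n, {linear P n.+1 -> P n}) j :
  exact_at (d j.+1) (d j) ->
  exact_at (precomp (Q := Q) (d j)) (precomp (Q := Q) (d j.+1)) <->
  coboundaries_exact Q d j.
Proof.
move=> dd; split=> [dE v vd|dE v].
  have [|u uv] := proj1 (dE (v : Hom _ _)); first exact: Hom_ext.
  by exists u => x; rewrite -uv.
split=> [vd|[u <-]]; last first.
  by apply: Hom_ext => x; rewrite /precomp /= (exact_comp0 dd) linear0.
have [x|u uv] := dE v; last by exists u; apply: Hom_ext.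
exact: (congr1 (fun f : Hom _ _ => f x) vd).
Qed.

(** Comparison of resolutions: chain maps f : P' -> P and g : P -> P' exist, and
    g f is homotopic to the identity by some s. The induction carries f and g in
    degrees j, j + 1 and s in degree j, with the homotopy relation in degree
    j + 1 only up to the kernel of d' j: the next s takes up the difference. *)
Lemma coboundaries_exact_indep (Q N : lmodType S)
    (P : nat -> lmodType S) (d : forall n, {linear P n.+1 -> P n})
    (eps : {linear P 0%N -> N})
    (P' : nat -> lmodType S) (d' : forall n, {linear P' n.+1 -> P' n})
    (eps' : {linear P' 0%N -> N}) j :
  projective_resolution d eps -> projective_resolution d' eps' ->
  coboundaries_exact Q d j -> coboundaries_exact Q d' j.
Proof.
move=> [Pp es d0 dd] [P'p e's d'0 d'd].
have ddE i := exact_comp0 (dd i); have d'dE i := exact_comp0 (d'd i).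
have [f0 [f1 [g0 [g1 [s [fE gE sE]]]]]] : exists
    (f0 : {linear P' j -> P j}) (f1 : {linear P' j.+1 -> P j.+1})
    (g0 : {linear P j -> P' j}) (g1 : {linear P j.+1 -> P' j.+1})
    (s : {linear P' j -> P' j.+1}),
    [/\ forall x, d j (f1 x) = f0 (d' j x),
        forall x, d' j (g1 x) = g0 (d j x) &
        forall x, d' j (g1 (f1 x) - x - s (d' j x)) = 0].
  elim: j => [|j [f0 [f1 [g0 [g1 [s [fE gE sE]]]]]]].
    have [f0 f0E] := P'p 0%N _ _ eps eps' es.
    have [g0 g0E] := Pp 0%N _ _ eps' eps e's.
    have [|f1 f1E] := projective_lift (h := f0 \o d' 0%N) (P'p 1%N) d0.
      by move=> x /=; rewrite f0E (exact_comp0 d'0).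
    have [|g1 g1E] := projective_lift (h := g0 \o d 0%N) (Pp 1%N) d'0.
      by move=> x /=; rewrite g0E (exact_comp0 d0).
    have [|s sE] := projective_lift (h := (g0 \o f0) \- idfun) (P'p 0%N) d'0.
      by move=> x /=; rewrite linearB g0E f0E subrr.
    exists f0, f1, g0, g1, s; split=> // x.
    by rewrite !linearB sE g1E /= f1E /= subrr.
  have [|f2 f2E] := projective_lift (h := f1 \o d' j.+1) (P'p j.+2) (dd j).
    by move=> x /=; rewrite fE d'dE linear0.
  have [|g2 g2E] := projective_lift (h := g1 \o d j.+1) (Pp j.+2) (d'd j).
    by move=> x /=; rewrite gE ddE linear0.
  have [|s' s'E] := projective_lift
      (h := (g1 \o f1) \- idfun \- (s \o d' j)) (P'p j.+1) (d'd j).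
    by move=> x /=; rewrite sE.
  exists f1, f2, g1, g2, s'; split=> // x.
  by rewrite !linearB s'E g2E /= f2E /= d'dE linear0 subr0 subrr.
move=> dE v vd'; have [|u uE] := dE (v \o g1).
  move=> x /=; have : d' j (g1 (d j.+1 x)) = 0 by rewrite gE ddE linear0.
  by move=> /d'd[y <-].
exists ((u \o f0) \- (v \o s)) => x /=.
have /d'd[y yE] := sE x; have := vd' y.
rewrite yE !linearB => /subr0_eq /eqP; rewrite subr_eq => /eqP vE.
by rewrite -fE uE /= vE addrAC subrr add0r.
Qed.

Lemma Ext_vanishesE (Q N : lmodType S) (P : nat -> lmodType S)
    (d : forall n, {linear P n.+1 -> P n})
    (eps : {linear P 0%N -> N}) j :
  projective_resolution d eps ->
  Ext_vanishes j.+1 N Q <-> coboundaries_exact Q d j.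
Proof.
move=> Pres; split=> [[P' [d' [eps' [P'res dE]]]]|dE].
  apply: (coboundaries_exact_indep P'res Pres); apply/coboundaries_exactE => //.
  by case: P'res.
exists P, d, eps; split=> //; apply/coboundaries_exactE => //.
by case: Pres.
Qed.

Definition resolvable (K : lmodType S) :=
  exists (P : nat -> lmodType S) (d : forall n, {linear P n.+1 -> P n})
    (eps : {linear P 0%N -> K}), projective_resolution d eps.

(** Dimension shifting: a resolution of K, followed by K -> P, resolves N. *)
Lemma Ext_vanishes_shift (Q K P N : lmodType S) (i : {linear K -> P})
    (p : {linear P -> N}) :
  short_exact i p -> projective P -> resolvable K ->
  (Ext_vanishes 1 N Q <->
    forall w : {linear K -> Q}, exists u : {linear P -> Q},
      forall x, u (i x) = w x) /\
  forall j, Ext_vanishes j.+2 N Q <-> Ext_vanishes j.+1 K Q.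
Proof.
move=> [ii ip ps] Pp [PK [d [eps res]]]; have [PKp es d0 dd] := res.
pose P' n : lmodType S := if n is n'.+1 then PK n' else P.
pose d' n : {linear P' n.+1 -> P' n} :=
  match n with 0%N => i \o eps | n'.+1 => d n' end.
have res' : @projective_resolution S N P' d' p.
  split=> [[|n]|||[|n]] //; [exact: PKp|move=> x| |exact: dd].
    split=> [/ip[c <-]|[y <-]]; last exact: exact_comp0 ip _.
    by have [y <-] := es c; exists y.
  move=> y; split=> [/= /(linear_inj0 ii)/d0 //|[z <-]] /=.
  by rewrite (exact_comp0 d0) linear0.
split=> [|j]; last first.
  by rewrite (Ext_vanishesE _ _ res') (Ext_vanishesE _ _ res).
rewrite (Ext_vanishesE _ _ res'); split=> [dE w|wE v vd].
  have [|u uE] := dE (w \o eps : {linear PK 0%N -> Q}).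
    by move=> x /=; rewrite (exact_comp0 d0) linear0.
  by exists u => x; have [y <-] := es x; exact: uE.
have [|w wvE] := linear_descend (h := v) es.
  by move=> x /d0[y <-]; exact: vd.
by have [u uE] := wE w; exists u => x /=; rewrite uE wvE.
Qed.

End Ext.

(** * Duality and transposes *)

Section Dual.
Variable R : pzRingType.

Lemma ring_projective : projective (R^o : lmodType R).
Proof.
have [i iE] := linear_row (fun _ : 'I_1 => idfun : {linear R^o -> R^o}).
have [r rE] := @rV_coord R 1 0.
apply: (@retract_projective _ _ 'rV[R]_1 i r); last exact: rV_projective.
by move=> x; rewrite rE iE.
Qed.

(** A map from M to a projective module factors through some R^n, where it
    can be extended coordinate by coordinate. *)
Lemma fg_approximation (M P : lmodType R) (a : {linear M -> P}) :
  finitely_generated M -> projective P ->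
  (forall u : {linear M -> R^o}, exists u' : {linear P -> R^o},
    forall x, u' (a x) = u x) ->
  approximation a.
Proof.
move=> Mfg Pp aR; split=> // Q Qp h.
have [n [v [w wv]]] := fg_to_projective h Mfg Qp.
have vR i : exists u' : {linear P -> R^o}, forall x, u' (a x) = v x 0 i.
  have [c cE] := rV_coord R i; have [u' u'E] := aR (c \o v).
  by exists u' => x; rewrite u'E /= cE.
have [v' v'E] := linear_row (fun i => projT1 (cid (vR i))).
exists (w \o v') => x /=; rewrite -wv; congr (w _); apply/rowP => i.
by rewrite v'E; case: cid => u /= ->.
Qed.

Fact dual_map_linear (M N : lmodType R) (f : {linear M -> N}) :
  linear (dual_map f).
Proof. by move=> a u v; apply: Hom_ext. Qed.

Definition dual_linear_map (M N : lmodType R) (f : {linear M -> N}) :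
  {linear dual N -> dual M} := linear_of (dual_map_linear f).

Fact eval_linear (M : lmodType R) (x : M) :
  linear (fun u : dual M => (u : Hom M R^o) x : R^c^o).
Proof. by []. Qed.

Definition eval (M : lmodType R) (x : M) : {linear dual M -> R^c^o} :=
  linear_of (eval_linear x).

Lemma dual_sum (M : lmodType R) n (c : 'I_n -> R^c) (u : 'I_n -> dual M) x :
  ((\sum_(i < n) c i *: u i : dual M) : Hom M R^o) x =
  \sum_(i < n) ((u i : Hom M R^o) x : R) * c i.
Proof.
by rewrite -[LHS]/(eval x _) linear_sum; apply: eq_bigr.
Qed.

Lemma rV_dual_basis n (M : lmodType R) (r : {linear 'rV[R]_n -> M})
    (u : dual M) (v : 'rV[R]_n) :
  (u : Hom M R^o) (r v) =
    \sum_(i < n) v 0 i * ((u : Hom M R^o) (r (delta_mx 0 i)) : R).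
Proof.
rewrite {1}[v]row_sum_delta !linear_sum; apply: eq_bigr => i _.
by rewrite !linearZ.
Qed.

(** A functional is determined by its values on the generators of M, so the dual
    of M embeds in a free module of finite rank. *)
Lemma dual_fg (M : lmodType R) : submodules_fg R^c^o ->
  finitely_generated M -> finitely_generated (dual M).
Proof.
move=> Rn /finitely_generatedE[n [r rs]].
have [h hE] := linear_row (fun i : 'I_n => eval (r (delta_mx 0 i))).
apply: (injective_fg Rn (f := h)); last exact: rV_finitely_generated.
apply: linear_inj => u u0; apply: Hom_ext => x; have [v <-] := rs x.
rewrite rV_dual_basis big1 // => i _.
by have /rowP/(_ i) := u0; rewrite hE mxE /= => ->; rewrite mulr0.
Qed.

(** The coordinates of the approximation are generators of the dual of M. *)
Lemma exists_approximation (M : lmodType R) : submodules_fg R^c^o ->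
  finitely_generated M ->
  exists n (a : {linear M -> 'rV[R]_n}), approximation a.
Proof.
move=> Rn Mfg; have [n [e eE]] := dual_fg Rn Mfg.
have [a aE] := linear_row (fun i => e i : Hom M R^o).
exists n, a; apply: fg_approximation => // [|u]; first exact: rV_projective.
have [c uE] := eE (u : dual M).
have hl : linear (fun v : 'rV[R]_n => \sum_(i < n) v 0 i * (c i : R) : R^o).
  move=> b v w; rewrite scaler_sumr -big_split; apply: eq_bigr => i _.
  by rewrite !mxE mulrDl -mulrA.
exists (linear_of hl) => x; have := dual_sum c e x; rewrite -uE /= => ->.
by apply: eq_bigr => i _; rewrite aE.
Qed.

Section FgProjective.
Variable P : lmodType R.
Hypothesis P_fgproj : fg_projective P.

Lemma fg_projective_separated (x : P) :
  (forall u : dual P, (u : Hom P R^o) x = 0) -> x = 0.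
Proof.
have [n [i [r ir]]] := fg_projective_retract P_fgproj => x0.
rewrite -[x]ir (_ : i x = 0) ?linear0 //; apply/rowP => j; rewrite mxE.
have [c cE] := rV_coord R j; rewrite -cE.
exact: (x0 (c \o i : {linear P -> R^o})).
Qed.

Lemma fg_projective_dual_basis : exists n (b : 'I_n -> dual P) (e : 'I_n -> P),
  forall u : dual P, u = \sum_(i < n) ((u : Hom P R^o) (e i) : R^c) *: b i.
Proof.
have [n [i [r ir]]] := fg_projective_retract P_fgproj.
have cE j := projT2 (cid (@rV_coord R n j)).
exists n, (fun j => (projT1 (cid (@rV_coord R n j)) \o i : {linear P -> R^o})).
exists (fun j => r (delta_mx 0 j)) => u; apply: Hom_ext => x.
rewrite dual_sum -[x in LHS]ir rV_dual_basis; apply: eq_bigr => j _.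
by rewrite /= cE.
Qed.

Lemma dual_fg_projective : fg_projective (dual P).
Proof.
have [n [b [e bE]]] := fg_projective_dual_basis.
split; first by exists n, b => u; exists (fun i => (u : Hom P R^o) (e i)).
have [i iE] := linear_row (fun j => eval (e j)).
have [r [rE _]] := linear_comb b.
apply: (@retract_projective _ _ 'rV[R^c]_n i r); last exact: rV_projective.
by move=> u; rewrite rE [RHS]bE; apply: eq_bigr => j _; rewrite iE.
Qed.

Lemma fg_projective_reflexive (w : {linear dual P -> R^c^o}) :
  exists x, forall u : dual P, w u = (u : Hom P R^o) x.
Proof.
have [n [b [e bE]]] := fg_projective_dual_basis.
exists (\sum_(i < n) (w (b i) : R) *: e i) => u.
rewrite [u in LHS]bE !linear_sum; apply: eq_bigr => i _.
by rewrite !linearZ.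
Qed.

End FgProjective.

Definition torsionless (M : lmodType R) :=
  forall x : M, (forall u : dual M, (u : Hom M R^o) x = 0) -> x = 0.

(** K is the image of the dual of f, hence a syzygy of the transpose of M,
    and the right-hand side is the vanishing of its first Ext. Functionals on
    K are functionals on the dual of P0 that kill the dual of M, which by
    reflexivity are evaluations at points y with p y killed by the dual of M;
    they extend to the dual of P1 exactly when y is in the image of f, i.e. p
    y = 0. *)
Lemma torsionless_extension (M P0 P1 : lmodType R) (K : lmodType R^c)
    (f : {linear P1 -> P0}) (p : {linear P0 -> M})
    (q : {linear dual P0 -> K}) (j : {linear K -> dual P1}) :
  fg_projective P1 -> fg_projective P0 -> exact_at f p -> surjective p ->
  surjective q -> injective j -> (forall u, j (q u) = dual_map f u) ->
  torsionless M <->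
  forall w : {linear K -> R^c^o}, exists v : {linear dual P1 -> R^c^o},
    forall x, v (j x) = w x.
Proof.
move=> P1p P0p fp ps qs ji jq.
have q0 (u : dual M) : q (dual_map p u) = 0.
  apply: ji; rewrite jq linear0; apply: Hom_ext => x.
  by rewrite /dual_map /precomp /= (exact_comp0 fp) linear0.
split=> [Mt w|wE x].
  have [y yE] :=
    fg_projective_reflexive P0p (w \o q : {linear dual P0 -> R^c^o}).
  have /fp[z zE] : p y = 0.
    apply: Mt => u; rewrite -[LHS]/((dual_map p u : Hom P0 R^o) y) -yE /=.
    by rewrite q0 linear0.
  exists (eval z) => k; have [u <-] := qs k.
  by rewrite jq -[RHS]/((w \o q) u) yE -zE.
have [y <-] := ps x => y0.
have [|w wq] := linear_descend (h := eval y) qs.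
  move=> u qu0; have [|u' u'E] := linear_descend (h := (u : Hom P0 R^o)) ps.
    move=> _ /fp[z <-]; have := jq u; rewrite qu0 linear0.
    by move=> /(congr1 (fun f : Hom P1 R^o => f z)).
  by rewrite /= -u'E; exact: (y0 (u' : dual M)).
have [v vE] := wE w; have [z zE] := fg_projective_reflexive P1p v.
apply/fp; exists z; apply/esym/subr0_eq/(fg_projective_separated P0p) => u.
by rewrite linearB -[X in X - _]/(eval y u) -wq -vE zE jq subrr.
Qed.

Hypothesis left_noeth : submodules_fg R^o.
Hypothesis right_noeth : submodules_fg R^c^o.

(** Let a : M -> R^n be an approximation with cokernel C. The dual of a maps
    onto the dual of M, so the image K of the dual of f, a syzygy of the
    transpose N of M, is a transpose of C, presented by P0 -> R^n -> C. Thus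
    Ext^1(N, R) = 0 means that M is torsionless, i.e. that a is injective,
    while the higher Ext of N are those of K and are handled by induction. *)
Lemma Ext_transpose_approx_tower k (M P0 P1 : lmodType R) (N : lmodType R^c)
    (f : {linear P1 -> P0}) (p : {linear P0 -> M})
    (q : {linear dual P1 -> N}) :
  fg_projective P1 -> fg_projective P0 -> exact_at f p -> surjective p ->
  exact_at (dual_map f) q -> surjective q ->
  (forall i, (1 <= i <= k)%N -> Ext_vanishes i N R^c^o) <-> approx_tower k M.
Proof.
elim: k M P0 P1 N f p q => [|k IH] M P0 P1 N f p q P1p P0p fp ps fq qs.
  by split=> // _ [|i]; rewrite ?ltn0 ?andbF.
have [K [s [j [ss ji js]]]] := exists_image (dual_linear_map f).
have Mfg : finitely_generated M := surj_finitely_generated ps (proj1 P0p).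
have Kres : resolvable K.
  apply: (exists_projective_resolution right_noeth).
  exact: surj_finitely_generated ss (proj1 (dual_fg_projective P0p)).
have jq : short_exact j q.
  split=> // x; split=> [/fq[u <-]|[k' <-]]; first by exists (s u).
  by have [u <-] := ss k'; rewrite js; apply/fq; exists u.
have [Ext1 Ext2] :=
  Ext_vanishes_shift R^c^o jq (proj2 (dual_fg_projective P1p)) Kres.
have tless := torsionless_extension P1p P0p fp ps ss ji js.
have [n [a aa]] := exists_approximation right_noeth Mfg.
have [C [c [ac cs]]] := exists_cokernel a.
have ai : torsionless M <-> injective a.
  split=> [Mt|ai x x0].
    apply: linear_inj => x ax0; apply: Mt => u.
    have [u' u'E] := (proj2 aa) _ ring_projective (u : Hom M R^o).
    by rewrite -u'E ax0 linear0.
  apply: (linear_inj0 ai); apply/rowP => i; rewrite mxE.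
  have [e eE] := rV_coord R i; rewrite -eE.
  exact: (x0 (e \o a : {linear M -> R^o})).
have KC : (forall i, (1 <= i <= k)%N -> Ext_vanishes i K R^c^o) <->
          approx_tower k C.
  have apc : exact_at (a \o p) c.
    move=> x; split=> [/ac[m <-]|[y <-]]; last exact: (exact_comp0 ac).
    by have [y <-] := ps m; exists y.
  apply: (IH C 'rV[R]_n P0 K (a \o p) c s) => //.
    split; [exact: rV_finitely_generated|exact: rV_projective].
  move=> u; split=> [su0|[v <-]].
    have [|u' u'E] := linear_descend (h := (u : Hom P0 R^o)) ps.
      move=> _ /fp[z <-]; have := js u; rewrite su0 linear0.
      by move=> /(congr1 (fun f : Hom P1 R^o => f z)).
    have [v vE] := (proj2 aa) _ ring_projective u'.
    by exists (v : dual 'rV[R]_n); apply: Hom_ext => x; rewrite -u'E -vE.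
  apply: ji; rewrite js linear0; apply: Hom_ext => x.
  by rewrite /= /dual_map /precomp /= (exact_comp0 fp) !linear0.
split=> [Nv|Mt].
  exists 'rV[R]_n, C, a, c; split=> //.
    by split=> //; apply/ai/tless/Ext1/Nv.
  by apply/KC => -[|i] // ik; apply/Ext2/Nv.
have [/ai/tless/Ext1 N1 /(_ _ _ ac cs)/KC Kv] := approx_tower_indep Mt aa.
by move=> [|[|i]] // ik; apply/Ext2/Kv.
Qed.

Lemma torsionfree_approx_tower k (M : lmodType R) :
  torsionfree k M <-> finitely_generated M /\ approx_tower k M.
Proof.
split=> [[Mfg [N [[P1 [P0 [f [p [q [[P1p P0p] [fp ps] [fq qs]]]]]]] NE]]]|].
  split=> //.
  exact/(Ext_transpose_approx_tower k P1p P0p fp ps fq qs).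
move=> [Mfg Mt]; split=> //.
have [m [n [f [p [fp ps]]]]] := fg_presentation left_noeth Mfg.
have [N [q [fq qs]]] := exists_cokernel (dual_linear_map f).
have fgp l : fg_projective 'rV[R]_l.
  by split; [exact: rV_finitely_generated|exact: rV_projective].
exists N; split.
  by exists 'rV[R]_m, 'rV[R]_n, f, p, q; split.
exact/(Ext_transpose_approx_tower k (fgp m) (fgp n) fp ps fq qs).
Qed.

End Dual.

(** * Restriction of scalars *)

(** The map t is meant to be the identity between two module structures on the
    same group, over S and over S'. *)
Lemma submodules_fg_transfer (S S' : pzRingType) (N : lmodType S)
    (M : lmodType S') (s : S -> S') (t : N -> M) :
  {morph t : x y / x - y} -> (forall a x, t (a *: x) = s a *: t x) ->
  surjective t -> submodules_fg N -> submodules_fg M.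
Proof.
move=> tB tZ ts Nn K Ksub; have [K0 Klin] := Ksub.
have t0 : t 0 = 0 by rewrite -{1}(subrr 0) tB subrr.
have tD x y : t (x + y) = t x + t y.
  by rewrite -[x in RHS](addrK y) tB subrK.
have [|e eE] := Nn (fun x => K (t x)).
  by split=> [|a x y Kx Ky]; rewrite ?t0 // tD tZ; exact: Klin.
exists (map t e) => y; split=> [|]; last first.
  by apply: lspan_min => // _ /mapP[x xe ->]; apply/eE/lspan_mem.
have [x <-] := ts y => /eE; elim: e x {eE} => [x ->|z e IH x /= [a]] /=.
  exact: t0.
by move=> /IH; rewrite tB tZ; exists (s a).
Qed.

Definition restriction (R A : pzRingType) (phi : {rmorphism R -> A})
  (N : lmodType A) : Type := N.

Section Restriction.
Variables (R A : pzRingType) (phi : {rmorphism R -> A}).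

Section RestrictedModule.
Variable N : lmodType A.

HB.instance Definition _ := GRing.Zmodule.on (restriction phi N).

Definition restriction_scale (a : R) (x : restriction phi N) :
    restriction phi N :=
  phi a *: (x : N).

Fact restriction_scaleA a b x :
  restriction_scale a (restriction_scale b x) = restriction_scale (a * b) x.
Proof. by rewrite /restriction_scale rmorphM scalerA. Qed.
Fact restriction_scale1 : left_id 1 restriction_scale.
Proof. by move=> x; rewrite /restriction_scale rmorph1 scale1r. Qed.
Fact restriction_scaleDr : right_distributive restriction_scale +%R.
Proof. by move=> a x y; rewrite /restriction_scale scalerDr. Qed.
Fact restriction_scaleDl x : {morph restriction_scale^~ x : a b / a + b}.
Proof. by move=> a b; rewrite /restriction_scale rmorphD scalerDl. Qed.
HB.instance Definition _ := GRing.Zmodule_isLmodule.Build R (restriction phi N)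
  restriction_scaleA restriction_scale1 restriction_scaleDr restriction_scaleDl.

End RestrictedModule.

Fact restriction_map_linear (N N' : lmodType A) (f : {linear N -> N'}) :
  linear (f : restriction phi N -> restriction phi N').
Proof. by move=> a x y; exact: linearP. Qed.

Definition restriction_map (N N' : lmodType A) (f : {linear N -> N'}) :
    {linear restriction phi N -> restriction phi N'} :=
  linear_of (restriction_map_linear f).

Hypothesis phi_finite : finite_rmorphism phi.

Lemma restriction_fg (N : lmodType A) :
  finitely_generated N -> finitely_generated (restriction phi N).
Proof.
move=> /finitely_generated_lspan[e eN].
have /finitely_generated_lspan[g gA] := proj1 phi_finite.
pose L : seq (restriction phi N) := [seq (a : A) *: (y : N) | a <- g, y <- e].
have [K0 Klin] := lspan_submodule L.
apply/finitely_generated_lspan; exists L => x.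
pose K (x : N) := forall c : A, lspan L (c *: x).
suff: K x by move=> /(_ 1); rewrite scale1r.
apply: lspan_min (eN x) => [|y ye c].
  split=> [c|a y z Ky Kz c]; first by rewrite scaler0.
  rewrite scalerDr scalerA -[_ *: y](@scale1r R (restriction phi N)).
  exact: Klin.
pose Ky (c : restr_left phi) := lspan L ((c : A) *: y).
apply: (lspan_min (K := Ky) _ _ (gA c)).
  split=> [|r a b La Lb]; first by rewrite /Ky scale0r.
  rewrite /Ky.
  have -> : ((r *: a + b : restr_left phi) : A) *: y =
      r *: ((a : A) *: y : restriction phi N) + (b : A) *: y.
    by rewrite scalerDl -scalerA.
  exact: Klin.
by move=> a ag; apply: lspan_mem; apply/allpairsP; exists (a, y).
Qed.

Lemma finite_left_noetherian : submodules_fg R^o -> submodules_fg A^o.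
Proof.
move=> Rn; have := fg_submodules_fg Rn (proj1 phi_finite).
apply: (@submodules_fg_transfer R A (restr_left phi) A^o
  phi (fun x => x)) => //.
by move=> x; exists x.
Qed.

Lemma finite_right_noetherian : submodules_fg R^c^o -> submodules_fg A^c^o.
Proof.
move=> Rn; have := fg_submodules_fg Rn (proj2 phi_finite).
apply: (@submodules_fg_transfer R^c A^c (bimod_right (restr_right phi)) A^c^o
  phi (fun x => x)) => //.
by move=> x; exists x.
Qed.

Hypothesis right_noeth : submodules_fg R^c^o.
Hypothesis A_tower : forall k, approx_tower k (restr_left phi).
Hypothesis Hom_AR_proj : projective (bimod_Hom (restr_left phi) R^o).

Lemma restriction_rV_approx_tower k n :
  approx_tower k (restriction phi 'rV[A]_n).
Proof.
elim: n => [|n IH].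
  apply: projective_approx_tower => M N g f _; exists \0 => x /=.
  by rewrite linear0 (_ : x = 0) ?linear0 //; apply/rowP; case.
have il : linear (fun x : restr_left phi =>
    (\row_(j < n.+1) (if j == 0 then x : A else 0)
       : restriction phi 'rV[A]_n.+1)).
  move=> a x y; apply/rowP => j; rewrite !mxE; case: eqP => // _.
  by rewrite mulr0 addr0.
have pl : linear (fun v : restriction phi 'rV[A]_n.+1 =>
    (\row_j (v : 'rV[A]_n.+1) 0 (lift ord0 j) : restriction phi 'rV[A]_n)).
  by move=> a x y; apply/rowP => j; rewrite !mxE.
have rl : linear (fun v : restriction phi 'rV[A]_n.+1 =>
    (v : 'rV[A]_n.+1) 0 0 : restr_left phi) by move=> a x y; rewrite !mxE.
have ri x : linear_of rl (linear_of il x) = x by rewrite /= mxE eqxx.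
have ip : short_exact (linear_of il) (linear_of pl).
  split=> [x y xy|v|w].
  - by rewrite -[x]ri xy ri.
  - split=> [/rowP v0|[x <-]]; last by apply/rowP => j; rewrite !mxE.
    exists ((v : 'rV[A]_n.+1) 0 0); apply/rowP => j; rewrite mxE.
    case: (unliftP 0 j) => [j'|] -> //.
    by have := v0 j'; rewrite !mxE => ->.
  - exists (\row_j if unlift 0 j is Some j' then (w : 'rV[A]_n) 0 j' else 0).
    by apply/rowP => j; rewrite !mxE liftK.
apply/(approx_tower_extension ip) => // Q Qp h.
by exists (h \o linear_of rl) => x /=; rewrite -[in RHS](ri x).
Qed.

(** Hom_R(N, R) = Hom_A(N, Hom_R(A, R)), and Hom_R(A, R) is projective over
    A, so that maps from N to it extend along a. *)
Lemma approximation_restriction_functional (N P : lmodType A)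
    (a : {linear N -> P}) (u : {linear restriction phi N -> R^o}) :
  approximation a ->
  exists u' : {linear restriction phi P -> R^o}, forall x, u' (a x) = u x.
Proof.
move=> [Pp aa].
have ul x : linear (fun c : restr_left phi => u ((c : A) *: (x : N))).
  move=> r c d; rewrite -[RHS](linearP u); congr (u _).
  by rewrite scalerDl -scalerA.
pose U (x : N) : bimod_Hom (restr_left phi) R^o :=
  (linear_of (ul x) : {linear restr_left phi -> R^o}).
have Ul : linear U.
  move=> c x y; apply: Hom_ext => d.
  by rewrite /= [LHS]/= scalerDr scalerA linearD.
have [U' U'E] := aa _ Hom_AR_proj (linear_of Ul).
have vl : linear (fun y : restriction phi P =>
    (U' y : Hom (restr_left phi) R^o) (1 : A) : R^o).
  move=> r x y; rewrite [_ *: x](_ : _ = phi r *: (x : P)) // linearP.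
  rewrite /= [in LHS]/bimod_Hom_fun /=.
  rewrite mul1r -[phi r]mulr1; congr (_ + _).
  exact: (linearZ_LR (U' x : Hom (restr_left phi) R^o) r (1 : A)).
exists (linear_of vl) => x /=; rewrite U'E /=.
by rewrite scale1r.
Qed.

(** Approximate N by a : N -> A^n over A, then A^n by l : A^n -> R^m over R; the
    composite approximates N over R. The cokernels of a, l a and l form a short
    exact sequence 0 -> C -> C' -> D -> 0, where D inherits a tower from A^n, so
    that C and C' have towers at the same time. *)
Lemma restriction_approx_tower k (N : lmodType A) : finitely_generated N ->
  approx_tower k N <-> approx_tower k (restriction phi N).
Proof.
elim: k N => // k IH N Nfg.
have [n [a aa]] :=
  exists_approximation (finite_right_noetherian right_noeth) Nfg.
have Pfg := restriction_fg (rV_finitely_generated A n).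
have [m [l la]] := exists_approximation right_noeth Pfg.
have [li lD] := approx_tower_indep (restriction_rV_approx_tower k.+1 n) la.
have ba : approximation (l \o restriction_map a).
  apply: fg_approximation (restriction_fg Nfg) (proj1 la) _ => u.
  have [u' u'E] := approximation_restriction_functional u aa.
  have [v vE] := (proj2 la) _ (@ring_projective R) u'.
  by exists v => x; rewrite /= vE u'E.
have [C [c [ac cs]]] := exists_cokernel a.
have [C' [c' [bc' c's]]] := exists_cokernel (l \o restriction_map a).
have [D [d [ld ds]]] := exists_cokernel l.
have [i iE] : exists i : {linear restriction phi C -> C'},
    forall x, i (c x) = c' (l x).
  apply: (linear_descend (q := restriction_map c) (h := c' \o l) cs).
  by move=> x /ac[y <-]; apply/bc'; exists y.
have [p pE] : exists p : {linear C' -> D}, forall x, p (c' x) = d x.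
  apply: linear_descend => // x /bc'[y <-]; exact: (exact_comp0 ld).
have ip : short_exact i p.
  split=> [|z|z]; last by have [x <-] := ds z; exists (c' x).
  - apply: linear_inj => z; have [x <-] := cs z; rewrite iE => /bc'[y].
    by move=> /li <-; exact: (exact_comp0 ac).
  - have [x <-] := c's z; rewrite pE; split=> [/ld[y <-]|[w]].
      by exists (c y); rewrite iE.
    have [y <-] := cs w; rewrite iE -pE => <-.
    by rewrite pE; exact: exact_comp0 ld y.
have iext : extends_to_projectives i.
  move=> Q Qp h; have [h1 h1E] := (proj2 la) Q Qp (h \o restriction_map c).
  have [h2 h2E] : exists h2 : {linear C' -> Q}, forall x, h2 (c' x) = h1 x.
    apply: linear_descend => // x /bc'[y <-] /=.
    by rewrite h1E /= (exact_comp0 ac) linear0.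
  by exists h2 => z; have [x <-] := cs z; rewrite iE h2E h1E.
have CC' := approx_tower_extension ip iext (lD D d ld ds).
have Cfg := surj_finitely_generated cs (rV_finitely_generated A n).
split=> Nt.
  have [ai /(_ _ _ ac cs)/(IH C Cfg)/CC' C't] := approx_tower_indep Nt aa.
  exists 'rV[R]_m, C', (l \o restriction_map a), c'; split=> //.
  by split=> // x y /li/ai.
have [bi /(_ _ _ bc' c's)/CC'/(IH C Cfg) Ct] := approx_tower_indep Nt ba.
exists 'rV[A]_n, C, a, c; split=> //; split=> // x y axy; apply: bi.
by rewrite /= axy.
Qed.

End Restriction.

(** * Tensor products *)

Definition additive_of (U V : zmodType) (f : U -> V)
    (fB : {morph f : x y / x - y}) : {additive U -> V} :=
  HB.pack_for {additive U -> V} f (GRing.isZmodMorphism.Build U V f fB).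

Section TensorTheory.
Variables (R : pzRingType) (X : lmodType R^c) (M : lmodType R).

Lemma tensB_pi (u v : {freeg (X * M)%type / int}) :
  \pi_(tensor X M) (u - v) = \pi_(tensor X M) u - \pi_(tensor X M) v.
Proof. exact: raddfB. Qed.

Lemma tensor_relator0 u : tensor_relator u -> \pi_(tensor X M) u = 0.
Proof.
move=> uR; rewrite -(raddf0 \pi_(tensor X M)).
apply/eqP; rewrite -Quotient.idealrBE subr0.
by apply/asboolP => I _; apply.
Qed.

Lemma tensDl x x' (m : M) : tens (x + x' : X) m = tens x m + tens x' m.
Proof.
apply/subr0_eq; rewrite opprD addrA -!tensB_pi; apply: tensor_relator0.
by constructor 1; exists x, x', m.
Qed.

Lemma tensDr (x : X) m m' : tens x (m + m' : M) = tens x m + tens x m'.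
Proof.
apply/subr0_eq; rewrite opprD addrA -!tensB_pi; apply: tensor_relator0.
by constructor 2; exists x, m, m'.
Qed.

Lemma tens0l (m : M) : tens (0 : X) m = 0.
Proof. by apply: (addrI (tens 0 m)); rewrite -tensDl !addr0. Qed.

Lemma tens0r (x : X) : tens x (0 : M) = 0.
Proof. by apply: (addrI (tens x 0)); rewrite -tensDr !addr0. Qed.

Lemma tensZ (a : R) (x : X) (m : M) : tens ((a : R^c) *: x) m = tens x (a *: m).
Proof.
apply/subr0_eq; rewrite -!tensB_pi; apply: tensor_relator0.
by constructor 3; exists a, x, m.
Qed.

Lemma tensor_ind (P : tensor X M -> Prop) :
  P 0 -> (forall t u, P t -> P u -> P (t - u)) -> (forall x m, P (tens x m)) ->
  forall t, P t.
Proof.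
move=> P0 PB PT t; rewrite -[t]reprK -[repr t]freeg_sumE raddf_sum.
have PD u v : P u -> P v -> P (u + v).
  move=> Pu Pv; rewrite -[v]opprK -[- v]sub0r.
  by apply: (PB) => //; exact: (PB).
have Pn u n : P u -> P (u *+ n).
  by move=> Pu; elim: n => // n; rewrite mulrS; exact: PD.
elim/big_ind: _ => // -[x m] _; move: (coeff _ _) => c.
rewrite -[c]intz -freegU_mulz raddfMz.
case: c => n; first exact/Pn/PT.
by rewrite NegzE mulrNz -sub0r; apply: PB => //; exact/Pn/PT.
Qed.

Lemma tensor_lift (V : zmodType) (b : X -> M -> V) :
  (forall m, {morph b^~ m : x y / x + y}) ->
  (forall x, {morph b x : m n / m + n}) ->
  (forall (a : R) x m, b ((a : R^c) *: x) m = b x (a *: m)) ->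
  exists h : {additive tensor X M -> V}, forall x m, h (tens x m) = b x m.
Proof.
move=> bDl bDr bZ.
pose F (u : {freeg (X * M)%type / int}) : zmodule V :=
  fglift (fun xm => b xm.1 xm.2 : zmodule V) u.
have FB : {morph F : u v / u - v} by exact: lift_is_additive.
have FU x m : F << (x, m) >> = b x m by rewrite /F liftU scale1r.
have F0 : F 0 = 0 by rewrite -(subrr 0) FB subrr.
have Frel u : u \in tensor_relations X M -> F u = 0.
  move=> /asboolP/(_ (fun v => F v == 0)) FI; apply/eqP/FI.
    split=> [|v w]; rewrite !unfold_in ?F0 // => /eqP v0 /eqP w0.
    by rewrite FB v0 w0 subrr.
  move=> v vR; rewrite unfold_in; apply/eqP.
  case: vR => [[x [y [m ->]]]|[x [m [n ->]]]|[a [x [m ->]]]]; rewrite !FB !FU.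
  - by rewrite bDl addrAC addrK subrr.
  - by rewrite bDr addrAC addrK subrr.
  - by rewrite bZ subrr.
pose h (t : tensor X M) : V := F (repr t).
have hpi u : h (\pi u) = F u.
  apply/subr0_eq; rewrite -[LHS]FB; apply: Frel.
  by rewrite Quotient.idealrBE reprK.
have hB : {morph h : t u / t - u}.
  by move=> t u; rewrite -{1}[t]reprK -{1}[u]reprK -tensB_pi hpi FB.
by exists (additive_of hB) => x m; rewrite /= /tens hpi FU.
Qed.

End TensorTheory.

Lemma tensor_mapB (R : pzRingType) (X X' : lmodType R^c) (M M' : lmodType R)
    (f : {linear X -> X'}) (g : {linear M -> M'}) :
  {morph tensor_map f g : t u / t - u}.
Proof.
move=> t u; rewrite -[t]reprK -[u]reprK -tensB_pi !tensor_map_pi.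
by rewrite free_mapB tensB_pi.
Qed.

Definition tensor_additive_map (R : pzRingType) (X X' : lmodType R^c)
    (M M' : lmodType R) (f : {linear X -> X'}) (g : {linear M -> M'}) :
    {additive tensor X M -> tensor X' M'} :=
  additive_of (tensor_mapB f g).

Lemma tensor_map0 (R : pzRingType) (X X' : lmodType R^c) (M M' : lmodType R)
    (f : {linear X -> X'}) (g : {linear M -> M'}) : tensor_map f g 0 = 0.
Proof. exact: raddf0 (tensor_additive_map f g). Qed.

(** * Flatness and factorization through projectives *)

Section Flat.
Variable R : pzRingType.
Hypothesis left_noeth : submodules_fg R^o.

Lemma exists_eval_tensor (N F : lmodType R) :
  exists ev : {additive tensor (dual N) F -> Hom N F},
    forall u z x, ev (tens u z) x = ((u : Hom N R^o) x : R) *: z.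
Proof.
have bl (u : dual N) z : linear (fun x => ((u : Hom N R^o) x : R) *: z : F).
  by move=> a x y; rewrite linearP scalerDl scalerA.
have [||a u z|ev evT] := tensor_lift
  (b := fun u z => (linear_of (bl u z) : Hom N F)).
- by move=> z u v; apply: Hom_ext => x; exact: scalerDl.
- by move=> u z z'; apply: Hom_ext => x; exact: scalerDr.
- by apply: Hom_ext => x; rewrite /= [RHS]scalerA.
by exists ev => u z x; rewrite evT.
Qed.

(** The equational criterion for flatness. For a presentation R^m -> R^n ->
    M, the images y_j of the generators of M in F satisfy the relations f,
    i.e. the tensor t = sum_j e_j (x) y_j is killed by the dual of f. By
    flatness t comes from a tensor u in M* (x) F, and psi is the map induced
    by u, which is a finite sum of maps factoring through R. *)
Lemma flat_factors_projective (M F : lmodType R) (psi : {linear M -> F}) :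
  finitely_generated M -> flat_left F ->
  exists (Q : lmodType R) (v : {linear M -> Q}) (w : {linear Q -> F}),
    projective Q /\ forall x, w (v x) = psi x.
Proof.
move=> Mfg Fflat.
have [m [n [f [p [fp ps]]]]] := fg_presentation left_noeth Mfg.
have fpdual : exact_at (dual_linear_map p) (dual_linear_map f).
  move=> u; split=> [uf|[v <-]]; last first.
    apply: Hom_ext => x.
    by rewrite /= /dual_map /precomp /= (exact_comp0 fp) linear0.
  have [|v vE] := linear_descend (h := (u : Hom _ R^o)) ps.
    by move=> _ /fp[x <-]; exact: (congr1 (fun g : Hom _ R^o => g x) uf).
  by exists (v : dual M); apply: Hom_ext => x; exact: vE.
have [evM evMT] := exists_eval_tensor M F.
have [evP evPT] := exists_eval_tensor 'rV[R]_n F.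
pose y j := psi (p (delta_mx 0 j)).
pose e l (j : 'I_l) : dual 'rV[R]_l :=
  (projT1 (cid (rV_coord R j)) : {linear _ -> R^o}).
have eE l (j : 'I_l) v : (e l j : Hom _ R^o) v = v 0 j.
  exact: (projT2 (cid (rV_coord R j)) v).
pose t := \sum_(j < n) tens (e n j) (y j) : tensor (dual 'rV[R]_n) F.
have t0 : tensor_map (dual_linear_map f) (idfun : {linear F -> F}) t = 0.
  pose fe : {additive _ -> _} :=
    tensor_additive_map (dual_linear_map f) (idfun : {linear F -> F}).
  rewrite -[LHS]/(fe t) raddf_sum.
  pose a i j : R := f (delta_mx 0 i) 0 j.
  transitivity (\sum_(j < n) \sum_(i < m) tens (e m i) (a i j *: y j)).
    apply: eq_bigr => j _; rewrite [LHS]tensor_map_tens.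
    have -> : dual_linear_map f (e n j) = \sum_(i < m) (a i j : R^c) *: e m i.
      apply: Hom_ext => v; rewrite dual_sum -[LHS]/((e n j : Hom _ R^o) (f v)).
      by rewrite rV_dual_basis; apply: eq_bigr => i _; rewrite !eE.
    rewrite (big_morph (fun x => tens x (y j)) (fun x x' => tensDl x x' _)
      (tens0l _ _)).
    by apply: eq_bigr => i _; rewrite tensZ.
  rewrite exchange_big big1 // => i _.
  rewrite -(big_morph (tens (e m i)) (tensDr _) (tens0r _ _)).
  rewrite (_ : \sum_(j < n) _ = psi (p (f (delta_mx 0 i)))); last first.
    rewrite [f _ in RHS]row_sum_delta !linear_sum; apply: eq_bigr => j _.
    by rewrite !linearZ.
  by rewrite (exact_comp0 fp) linear0 tens0r.
have [u uE] := proj1 (Fflat _ _ _ _ _ fpdual t) t0.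
have evp (s : tensor (dual M) F) x :
    evP (tensor_map (dual_linear_map p) (idfun : {linear F -> F}) s) x =
    evM s (p x).
  move: s; apply: tensor_ind => [|s s' sE s'E|w z].
  - by rewrite tensor_map0 !raddf0.
  - by rewrite tensor_mapB !raddfB /= sE s'E.
  - by rewrite tensor_map_tens evPT evMT.
have psiE x : evM u x = psi x.
  have [v <-] := ps x; rewrite -evp uE raddf_sum.
  rewrite [v in RHS]row_sum_delta !linear_sum.
  rewrite (big_morph (fun g : Hom 'rV[R]_n F => g v) (fun _ _ => erefl) erefl).
  by apply: eq_bigr => j _; rewrite evPT eE !linearZ.
suff [Q [v [w [Qp vw]]]] : exists (Q : lmodType R) (v : {linear M -> Q})
    (w : {linear Q -> F}), projective Q /\ forall x, w (v x) = evM u x.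
  by exists Q, v, w; split=> // x; rewrite vw psiE.
elim/tensor_ind: u {uE psiE}.
- exists 'rV[R]_0, \0, \0.
  by split=> [|x]; [exact: rV_projective|rewrite (raddf0 evM)].
- move=> r s [Q1 [v1 [w1 [Q1p vw1]]]] [Q2 [v2 [w2 [Q2p vw2]]]].
  have [v vE] := linear_pair v1 v2.
  have [w wE] := linear_copair w1 (\- w2 : {linear Q2 -> F}).
  exists (Q1 * Q2)%type, v, w; split=> [|x]; first exact: prod_projective.
  by rewrite wE vE raddfB /= vw1 vw2.
- move=> u z.
  have wl : linear (fun r : R^o => (r : R) *: z).
    by move=> a r s; rewrite scalerDl scalerA.
  exists R^o, (u : Hom M R^o), (linear_of wl).
  by split=> [|x]; [exact: ring_projective|rewrite evMT].
Qed.

End Flat.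

(** * Base change along a bimodule *)

Section BimoduleTensor.
Variables (A R : pzRingType) (T : bimodule A R).

Fact left_mul_linear (a : A) :
  linear (fun x : bimod_right T => (a *: (x : T)) : bimod_right T).
Proof.
move=> r x y; rewrite [LHS]scalerDr; congr (_ + _).
exact/esym/ractZ.
Qed.

Definition left_mul (a : A) : {linear bimod_right T -> bimod_right T} :=
  linear_of (left_mul_linear a).

Section Module.
Variable M : lmodType R.

Definition base_change : Type := tensor (bimod_right T) M.
HB.instance Definition _ := GRing.Zmodule.on base_change.

Definition pure (x : T) (m : M) : base_change :=
  tens (x : bimod_right T) m.

Lemma pureDl x x' m : pure (x + x') m = pure x m + pure x' m.
Proof. exact: tensDl. Qed.

Lemma pureDr x m m' : pure x (m + m') = pure x m + pure x m'.
Proof. exact: tensDr. Qed.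

Lemma pure0l m : pure 0 m = 0.
Proof. exact: tens0l. Qed.

Lemma pure0r x : pure x 0 = 0.
Proof. exact: tens0r. Qed.

Lemma pure_ract x r m : pure (ract x r) m = pure x (r *: m).
Proof. exact: (@tensZ _ (bimod_right T)). Qed.

Definition base_change_scale (a : A) : base_change -> base_change :=
  tensor_additive_map (left_mul a) (idfun : {linear M -> M}).

Lemma base_change_scale_pure a x m :
  base_change_scale a (pure x m) = pure (a *: x) m.
Proof. exact: tensor_map_tens. Qed.

Lemma base_change_ind (P : base_change -> Prop) :
  P 0 -> (forall t u, P t -> P u -> P (t - u)) -> (forall x m, P (pure x m)) ->
  forall t, P t.
Proof. exact: tensor_ind. Qed.

Lemma base_change_scaleB a :
  {morph base_change_scale a : t u / t - u}.
Proof. exact: tensor_mapB. Qed.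

Lemma base_change_scale0 a : base_change_scale a 0 = 0.
Proof. exact: tensor_map0. Qed.

Fact base_change_scaleA a b t :
  base_change_scale a (base_change_scale b t) = base_change_scale (a * b) t.
Proof.
move: t; apply: base_change_ind => [|t u tE uE|x m].
- by rewrite !base_change_scale0.
- by rewrite !base_change_scaleB tE uE.
- by rewrite !base_change_scale_pure scalerA.
Qed.
Fact base_change_scale1 : left_id 1 base_change_scale.
Proof.
apply: base_change_ind => [|t u tE uE|x m].
- exact: base_change_scale0.
- by rewrite base_change_scaleB tE uE.
- by rewrite base_change_scale_pure scale1r.
Qed.
Fact base_change_scaleDr : right_distributive base_change_scale +%R.
Proof.
move=> a t u; pose idM : {linear M -> M} := idfun.
exact: (raddfD (tensor_additive_map (left_mul a) idM)).
Qed.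
Fact base_change_scaleDl t : {morph base_change_scale^~ t : a b / a + b}.
Proof.
move=> a b; move: t; apply: base_change_ind => [|t u tE uE|x m].
- by rewrite !base_change_scale0 addr0.
- by rewrite !base_change_scaleB tE uE opprD addrACA.
- by rewrite !base_change_scale_pure scalerDl pureDl.
Qed.
HB.instance Definition _ := GRing.Zmodule_isLmodule.Build A base_change
  base_change_scaleA base_change_scale1 base_change_scaleDr base_change_scaleDl.

Lemma scale_pure a x m : a *: pure x m = pure (a *: x) m.
Proof. exact: base_change_scale_pure. Qed.

Lemma base_change_linear_eq (V : lmodType A) (f g : {linear base_change -> V}) :
  (forall x m, f (pure x m) = g (pure x m)) -> f =1 g.
Proof.
move=> fg; apply: base_change_ind => [|t u tE uE|//]; first by rewrite !linear0.
by rewrite !linearB tE uE.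
Qed.

Lemma base_change_lift (V : lmodType A) (g : {linear M -> bimod_Hom T V}) :
  exists h : {linear base_change -> V},
    forall x m, h (pure x m) = (g m : Hom T V) x.
Proof.
have [m x y|x m m'|r x m|h hE] := @tensor_lift _ (bimod_right T) M V
  (fun x m => (g m : Hom T V) x).
- exact: linearD.
- by rewrite linearD.
- by rewrite linearZ.
have hl : linear (h : base_change -> V).
  move=> a t u; rewrite -[LHS]/(h (a *: t + u)) raddfD; congr (_ + _).
  move: t; apply: base_change_ind => [|t t' tE t'E|x m].
  - by rewrite !raddf0.
  - by rewrite !raddfB tE t'E.
  - by rewrite scale_pure !hE linearZ.
by exists (linear_of hl) => x m; rewrite -hE.
Qed.

Lemma base_change_curry (V : lmodType A) (h : {linear base_change -> V}) :
  exists g : {linear M -> bimod_Hom T V},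
    forall x m, (g m : Hom T V) x = h (pure x m).
Proof.
have gl m : linear (fun x : T => h (pure x m)).
  move=> a x y; rewrite -linearP; congr (h _).
  by rewrite scale_pure pureDl.
have gl' : linear (fun m => (linear_of (gl m) : Hom T V) : bimod_Hom T V).
  move=> r m m'; apply: Hom_ext => x /=.
  rewrite [LHS]/= /bimod_Hom_fun /= -linearD; congr (h _).
  by rewrite pureDr pure_ract.
by exists (linear_of gl').
Qed.

End Module.

Lemma base_change_fg (M : lmodType R) :
  finitely_generated T -> finitely_generated M ->
  finitely_generated (base_change M).
Proof.
move=> /finitely_generated_lspan[e eT] /finitely_generated_lspan[g gM].
pose L := [seq pure x m | x <- e, m <- g].
have [L0 Llin] := lspan_submodule L.
have LD t u : lspan L t -> lspan L u -> lspan L (t + u).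
  by rewrite -{2}[t]scale1r; exact: Llin.
apply/finitely_generated_lspan; exists L; apply: base_change_ind => //.
  by move=> t u Lt Lu; rewrite addrC -scaleN1r; exact: Llin.
move=> x m; move: x.
apply: (lspan_min (K := fun m => forall x, lspan L (pure x m)) _ _ (gM m)).
  split=> [x|r n n' Ln Ln' x]; first by rewrite pure0r.
  by rewrite pureDr; apply: LD => //; rewrite -pure_ract; exact: Ln.
move=> {}m mg x.
apply: (lspan_min (K := fun x => lspan L (pure x m)) _ _ (eT x)).
  split=> [|a y z Ly Lz]; first by rewrite pure0l.
  rewrite (_ : pure _ m = a *: pure y m + pure z m); first exact: Llin.
  by rewrite scale_pure pureDl.
by move=> y ye; apply: lspan_mem; apply/allpairsP; exists (y, m).
Qed.

Fact base_change_map_linear (M N : lmodType R) (f : {linear M -> N}) :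
  linear (tensor_map (idfun : {linear bimod_right T -> bimod_right T}) f :
    base_change M -> base_change N).
Proof.
move=> a t u.
rewrite [LHS](raddfD (tensor_additive_map idfun f)); congr (_ + _).
move: t; apply: base_change_ind => [|t t' tE t'E|x m].
- by rewrite scaler0 /= tensor_map0 scaler0.
- by rewrite scalerBr /= !tensor_mapB scalerBr; congr (_ - _).
- rewrite scale_pure /= /pure !tensor_map_tens.
  by rewrite -[RHS]/(a *: pure x (f m)) scale_pure.
Qed.

Definition base_change_map (M N : lmodType R) (f : {linear M -> N}) :
  {linear base_change M -> base_change N} :=
  linear_of (base_change_map_linear f).

Lemma base_change_map_pure (M N : lmodType R) (f : {linear M -> N}) x m :
  base_change_map f (pure x m) = pure x (f m).
Proof. exact: tensor_map_tens. Qed.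

(** Hom_A(T (x) P, -) = Hom_R(P, Hom_A(T, -)) is a composite of exact
    functors. *)
Lemma base_change_projective (P : lmodType R) :
  projective T -> projective P -> projective (base_change P).
Proof.
move=> Tp Pp M N g f gs.
pose g_ (h : bimod_Hom T M) : bimod_Hom T N :=
  (g \o (h : Hom T M) : {linear T -> N}).
have gl : linear g_ by move=> r h h'; apply: Hom_ext => x; exact: linearD.
have [f' f'E] := base_change_curry f.
have [|h hE] := Pp _ _ (linear_of gl) f'.
  move=> u; have [v vE] := Tp _ _ g (u : Hom T N) gs.
  by exists v; apply: Hom_ext.
have [h' h'E] := base_change_lift h.
exists h' => t; rewrite -[LHS]/((g \o h') t); move: t.
apply: base_change_linear_eq => x m /=.
by rewrite h'E -f'E -hE.
Qed.

Lemma base_change_surjective (M N : lmodType R) (f : {linear M -> N}) :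
  surjective f -> surjective (base_change_map f).
Proof.
move=> fs; apply: base_change_ind => [|_ _ [t <-] [u <-]|x n].
- by exists 0; rewrite linear0.
- by exists (t - u); rewrite linearB.
- by have [m <-] := fs n; exists (pure x m); rewrite base_change_map_pure.
Qed.

Hypothesis T_fgproj : fg_projective T.
Hypothesis T_faithfully_flat : faithfully_flat_right (bimod_right T).
Hypothesis dual_T_flat : flat_left (bimod_Hom T A^o).
Hypothesis left_noeth : submodules_fg R^o.
Hypothesis right_noeth : submodules_fg R^c^o.

(** Injectivity of f is exactness at M of the zero map followed by f. *)
Lemma base_change_injective (M N : lmodType R) (f : {linear M -> N}) :
  injective f <-> injective (base_change_map f).
Proof.
have ffE := T_faithfully_flat (\0 : {linear M -> M}) f.
have t0 t : tensor_map (idfun : {linear bimod_right T -> bimod_right T})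
    (\0 : {linear M -> M}) t = 0.
  move: t; apply: tensor_ind => [|t u t0 u0|x m]; first exact: tensor_map0.
    by rewrite tensor_mapB t0 u0 subrr.
  by rewrite tensor_map_tens /= tens0r.
split=> fi; apply: linear_inj => t.
  move=> tf0; have [|u <-] := proj1 (proj1 ffE _ t) tf0; last exact: t0.
  move=> x; split=> [/(linear_inj0 fi) ->|[y <-]]; first by exists 0.
  exact: linear0.
move=> ft0; have [|u <-//] := proj1 (proj2 ffE _ t) ft0.
move=> s; split=> [/(linear_inj0 fi) ->|[u <-]]; first by exists 0; exact: t0.
by rewrite t0 tensor_map0.
Qed.

(** Hom_A(T (x) M, A) = Hom_R(M, Hom_A(T, A)), and maps from M to the flat
    module Hom_A(T, A) factor through projectives, hence extend along a. *)
Lemma base_change_approximation (M P : lmodType R) (a : {linear M -> P}) :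
  finitely_generated M -> approximation a -> approximation (base_change_map a).
Proof.
move=> Mfg [Pp aa]; apply: fg_approximation => [||u].
- exact: base_change_fg (proj1 T_fgproj) Mfg.
- exact: base_change_projective (proj2 T_fgproj) Pp.
have [g gE] := base_change_curry u.
have [Q [v [w [Qp vw]]]] :=
  flat_factors_projective left_noeth g Mfg dual_T_flat.
have [v' v'E] := aa Q Qp v.
have [u' u'E] := base_change_lift (w \o v').
exists u' => t; rewrite -[LHS]/((u' \o base_change_map a) t); move: t.
apply: base_change_linear_eq => x m.
rewrite -[LHS]/(u' (base_change_map a (pure x m))) base_change_map_pure.
by rewrite u'E /= v'E vw gE.
Qed.

(** Base change turns an approximation and its cokernel over R into an
    approximation and its cokernel over A, and injectivity is reflected. *)
Lemma base_change_approx_tower k (M : lmodType R) : finitely_generated M ->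
  approx_tower k M <-> approx_tower k (base_change M).
Proof.
elim: k M => // k IH M Mfg.
have [n [a aa]] := exists_approximation right_noeth Mfg.
have [C [c [ac cs]]] := exists_cokernel a.
have Cfg := surj_finitely_generated cs (rV_finitely_generated R n).
have Taa := base_change_approximation Mfg aa.
have Tac : exact_at (base_change_map a) (base_change_map c).
  exact: (proj1 (T_faithfully_flat a c) ac).
have Tcs := base_change_surjective cs.
split=> Mt.
  have [ai /(_ _ _ ac cs)/(IH C Cfg) Ct] := approx_tower_indep Mt aa.
  exists (base_change 'rV[R]_n), (base_change C), (base_change_map a).
  exists (base_change_map c); split=> //; split=> //.
  exact/base_change_injective.
have [Tai /(_ _ _ Tac Tcs)/(IH C Cfg) Ct] := approx_tower_indep Mt Taa.
exists 'rV[R]_n, C, a, c; split=> //; split=> //.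
exact/base_change_injective.
Qed.

End BimoduleTensor.

Theorem theorem1p3 (R A : pzRingType) (phi : {rmorphism R -> A})
    (R_noetherian : noetherian_ring R)
    (phi_finite : finite_rmorphism phi)
    (phi_qff : quasi_faithfully_flat_extension phi)
    (A_Gproj : Gorenstein_projective (restr_left phi))
    (Hom_AR_proj : projective (bimod_Hom (restr_left phi) R^o))
    (k : nat) (k_gt0 : (0 < k)%N) :
  extension_closed (@torsionfree R k) <-> extension_closed (@torsionfree A k).
Proof.
have Rl := noetherian_submodules_fg (proj1 R_noetherian).
have Rr := noetherian_submodules_fg (proj2 R_noetherian).
have Al := finite_left_noetherian phi_finite Rl.
have Ar := finite_right_noetherian phi_finite Rr.
have A_tower l := Gorenstein_projective_approx_tower l A_Gproj.
have tfR := torsionfree_approx_tower Rl Rr k.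
have tfA := torsionfree_approx_tower Al Ar k.
have [T [Tp Tff Tflat]] := phi_qff.
split=> ext X Y Z f g Xfg Yfg Zfg fi fg gs /[!(tfR, tfA)] -[_ Xt] [_ Zt].
  have res N (Nfg : finitely_generated N) :=
    restriction_approx_tower phi_finite Rr A_tower Hom_AR_proj k Nfg.
  have rfg N (Nfg : finitely_generated N) := restriction_fg phi_finite Nfg.
  split=> //; apply/res => //.
  have /tfR[] // : torsionfree k (restriction phi Y).
  apply: (ext _ _ _ (restriction_map phi f) (restriction_map phi g)) => //;
    rewrite ?tfR; try exact: rfg.
  - by split; [exact: rfg|apply/res].
  - by split; [exact: rfg|apply/res].
have tow M (Mfg : finitely_generated M) :=
  base_change_approx_tower Tp Tff Tflat Rl Rr k Mfg.
have tfg M (Mfg : finitely_generated M) := base_change_fg (proj1 Tp) Mfg.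
split=> //; apply/tow => //.
have /tfA[] // : torsionfree k (base_change T Y).
apply: (ext _ _ _ (base_change_map T f) (base_change_map T g)) => //;
  rewrite ?tfA; try exact: tfg.
- exact/(base_change_injective Tff).
- exact: (proj1 (Tff _ _ _ f g) fg).
- exact: base_change_surjective.
- by split; [exact: tfg|apply/tow].
- by split; [exact: tfg|apply/tow].
Qed.
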